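(* Let $P$ be a polytope and let $\mathcal{F}$ be any facial building set for the oriented matroid $\mathcal{M}(A_P)$ of the homogenized vertex configuration $A_P$ of $P$. Then the facial nested complex of $(\mathcal{F},\mathcal{M}(A_P))$ is isomorphic to the boundary complex of a convex polytope. When $\mathcal{F}$ is connected, this polytope is obtained by a sequence of stellar subdivisions of $P$, or dually, by a sequence of face truncations of the polar of $P$.
   Context: $A_P=\{(v,1): v\text{ vertex of }P\}$, and $\mathcal{M}(A_P)$ is its oriented matroid (signs of linear dependences and of linear evaluations). It is acyclic. A face of an acyclic oriented matroid $\mathcal{M}$ on $S$ is a set $F\subseteq S$ such that $(S\setminus F,\varnothing)$ is a covector; faces ordered by inclusion form the Las Vergnas face lattice $\mathcal{L}(\mathcal{M})$. For $\mathcal{M}(A_P)$, $\mathcal{L}(\mathcal{M}(A_P))$ is the face lattice of $P$, each face being identified with its vertex set. For a finite lattice $\mathcal{L}$, an $\mathcal{L}$-building set is a subset $\mathcal{F}\subseteq\mathcal{L}_{>\hat 0}$ such that for every $Y\in\mathcal{L}_{>\hat 0}$, with $\{B_1,\dots,B_k\}=\max(\mathcal{F}_{\le Y})$, there is a poset isomorphism $\prod_{j}\mathcal{L}_{\le B_j}\to\mathcal{L}_{\le Y}$ whose $j$-th component is the inclusion. Let $\kappa(\mathcal{F})=\max(\mathcal{F})$; $\mathcal{F}$ is connected if $|\kappa(\mathcal{F})|=1$. An $\mathcal{L}$-nested set on $\mathcal{F}$ is a subset $\mathcal{N}\subseteq\mathcal{F}$ containing $\kappa(\mathcal{F})$ such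 that for any $k\ge2$ pairwise incomparable $B_1,\dots,B_k\in\mathcal{N}\setminus\kappa(\mathcal{F})$, the join $B_1\vee\cdots\vee B_k$ is not in $\mathcal{F}$. The $\mathcal{L}$-nested complex of $\mathcal{F}$ is the simplicial complex with faces $\mathcal{N}\setminus\kappa(\mathcal{F})$. A facial building set for $\mathcal{M}$ is an $\mathcal{L}(\mathcal{M})$-building set; its facial nested complex is its $\mathcal{L}(\mathcal{M})$-nested complex. A stellar subdivision of a polytope $P$ at a proper face $F$ is $\mathrm{conv}(P\cup\{v_F\})$, where $v_F$ is a point of the affine span of $P$ that is beyond all facets of $P$ containing $F$ and beneath all other facets. A truncation of a polytope $Q$ at a face $G$ is the intersection of $Q$ with a halfspace that does not meet $G$ and contains (in its interior) all vertices of $Q$ not in $G$. The polar of $P$ is taken within the affine span of $P$ with an origin in its relative interior. *)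

(* Defs.v *)
From HB Require Import structures.
From mathcomp Require Import all_boot all_order all_algebra finmap.
From mathcomp Require Import all_classical all_reals all_analysis.
From Stdlib Require Export Relation_Operators.

Set Implicit Arguments.
Unset Strict Implicit.
Unset Printing Implicit Defensive.

Import Order.TTheory GRing.Theory Num.Theory.
Import numFieldNormedType.Exports.

Local Open Scope ring_scope.

(** * Oriented matroids *)

(* A signed subset of S is the pair of its positive part and its negative
   part. *)
Section SignedSets.
Variable S : finType.
Implicit Types X Y : {set S} * {set S}.

Definition signed_opp X := (X.2, X.1).

Definition signed_comp X Y :=
  (X.1 :|: (Y.1 :\: X.2), X.2 :|: (Y.2 :\: X.1)).

Definition signed_sep X Y := (X.1 :&: Y.2) :|: (X.2 :&: Y.1).

End SignedSets.

(* Oriented matroids are given by their covectors; the vectors are then the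
   signed subsets orthogonal to all the covectors. *)
Record orientedMatroid (S : finType) := OrientedMatroid {
  covectors : {set {set S} * {set S}};
  covector_disj : forall X, X \in covectors -> [disjoint X.1 & X.2];
  covector0 : (finset.set0, finset.set0) \in covectors;
  covectorN : forall X, X \in covectors -> signed_opp X \in covectors;
  covector_comp : forall X Y, X \in covectors -> Y \in covectors ->
    signed_comp X Y \in covectors;
  covector_elim : forall X Y e, X \in covectors -> Y \in covectors ->
    e \in signed_sep X Y ->
    exists Z, [/\ Z \in covectors, e \notin Z.1 :|: Z.2,
      Z.1 :\: signed_sep X Y = (signed_comp X Y).1 :\: signed_sep X Y
    & Z.2 :\: signed_sep X Y = (signed_comp X Y).2 :\: signed_sep X Y]
}.

Definition acyclic (S : finType) (M : orientedMatroid S) : bool :=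
  (finset.setT, finset.set0) \in covectors M.

(** * The Las Vergnas face lattice *)

(* When M is acyclic, the least element is the empty face. *)
Section LasVergnas.
Variables (S : finType) (M : orientedMatroid S).

Definition lv_face (F : {set S}) : bool :=
  (~: F, finset.set0) \in covectors M.

Lemma lv_faceT : lv_face finset.setT.
Proof. by rewrite /lv_face finset.setCT covector0. Qed.

Lemma lv_faceI F G : lv_face F -> lv_face G -> lv_face (F :&: G)%SET.
Proof.
move=> hF hG; have := covector_comp hF hG.
by rewrite /lv_face /signed_comp /= !finset.setD0 finset.set0D finset.setU0
  finset.setCI.
Qed.

Record lvFace := LVFace { lv_set :> {set S}; lv_faceP : lv_face lv_set }.

HB.instance Definition _ := [isSub for lv_set].
HB.instance Definition _ := [Finite of lvFace by <:].

Fact lv_display : Order.disp_t. Proof. exact: (Order.Disp tt tt). Qed.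

Definition lv_le (F G : lvFace) := (F : {set S}) \subset G.

Fact lv_le_refl : reflexive lv_le.
Proof. by move=> F; apply: subxx. Qed.

Fact lv_le_anti : antisymmetric lv_le.
Proof. by move=> F G FG; apply/val_inj/eqP; rewrite finset.eqEsubset. Qed.

Fact lv_le_trans : transitive lv_le.
Proof. by move=> G F H; apply: fintype.subset_trans. Qed.

HB.instance Definition _ :=
  Order.Le_isPOrder.Build lv_display lvFace lv_le_refl lv_le_anti lv_le_trans.

Lemma lv_leE (F G : lvFace) : (F <= G)%O = ((F : {set S}) \subset G).
Proof. by []. Qed.

Definition lv_top := LVFace lv_faceT.
Definition lv_meet (F G : lvFace) := LVFace (lv_faceI (lv_faceP F) (lv_faceP G)).

Definition lv_Meet (P : pred lvFace) : lvFace := \big[lv_meet/lv_top]_(F | P F) F.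

Definition lv_bot := lv_Meet predT.
Definition lv_join (F G : lvFace) :=
  lv_Meet [pred H | (F <= H)%O && (G <= H)%O].

Fact lv_le1 (F : lvFace) : (F <= lv_top)%O.
Proof. by rewrite lv_leE finset.subsetT. Qed.

Fact lv_lexI (F G H : lvFace) : (F <= lv_meet G H)%O = (F <= G)%O && (F <= H)%O.
Proof. by rewrite !lv_leE finset.subsetI. Qed.

Lemma lv_le_Meet (P : pred lvFace) (F : lvFace) :
  reflect (forall G, P G -> (F <= G)%O) (F <= lv_Meet P)%O.
Proof.
have -> : (F <= lv_Meet P)%O = [forall G, P G ==> (F <= G)%O].
  rewrite /lv_Meet -big_andE (big_morph (fun G => (F <= G)%O) (lv_lexI F) (lv_le1 F)).
  by rewrite big_mkcond.
apply: (iffP forallP) => [h G PG|h G]; first exact: implyP (h G) PG.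
by apply/implyP; apply: h.
Qed.

Fact lv_le0 (F : lvFace) : (lv_bot <= F)%O.
Proof. by have /lv_le_Meet := lexx lv_bot; apply. Qed.

Fact lv_leUx (F G H : lvFace) : (lv_join F G <= H)%O = (F <= H)%O && (G <= H)%O.
Proof.
apply/idP/andP => [h|[FH GH]]; last first.
  by have /lv_le_Meet := lexx (lv_join F G); apply; rewrite /= FH GH.
by split; apply: le_trans h; apply/lv_le_Meet => K /= /andP[].
Qed.

HB.instance Definition _ := Order.hasBottom.Build lv_display lvFace lv_le0.
HB.instance Definition _ := Order.hasTop.Build lv_display lvFace lv_le1.
HB.instance Definition _ :=
  Order.POrder_isMeetSemilattice.Build lv_display lvFace lv_lexI.
HB.instance Definition _ :=
  Order.POrder_isJoinSemilattice.Build lv_display lvFace lv_leUx.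

End LasVergnas.

(** * Building sets and nested sets of a finite lattice *)

Section Nested.
Context {disp : Order.disp_t} {L : finTBLatticeType disp}.
Implicit Types (B C Y : L) (F N A : {set L}).
Local Open Scope order_scope.

Definition max_elts F : {set L} :=
  [set B in F | [forall C in F, (B <= C) ==> (C == B)]].

Definition below Y : Type := {x : L | x <= Y}.

(* Since phi is an isomorphism from the product of the lower intervals at the
   elements B of K, its j-th component being the inclusion means that it sends
   a family whose components other than the j-th are \bot to its j-th
   component. *)
Definition building_set F : Prop :=
  (forall B, B \in F -> \bot < B) /\
  forall Y, \bot < Y ->
    let K := max_elts [set B in F | B <= Y] in
    exists phi : (forall j : {B | B \in K}, below (val j)) -> below Y,
      [/\ bijective phi,
          forall x y, val (phi x) <= val (phi y) <->
                      (forall j, val (x j) <= val (y j))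
        & forall (j : {B | B \in K}) (x : forall i : {B | B \in K}, below (val i)),
            (forall i, i != j -> val (x i) = \bot) ->
            val (phi x) = val (x j)].

Definition kappa F := max_elts F.

Definition building_connected F := #|kappa F| = 1%N.

Definition incomparable_set A :=
  forall B C, B \in A -> C \in A -> B != C -> B >< C.

Definition nested_set F N : Prop :=
  [/\ N \subset F, kappa F \subset N &
      forall A, A \subset N :\: kappa F -> (1 < #|A|)%N ->
        incomparable_set A -> \join_(B in A) B \notin F].

End Nested.

Section Complexes.
Local Open Scope classical_set_scope.

Definition nested_complex (disp : Order.disp_t) (L : finTBLatticeType disp)
    (F : {set L}) : set (set L) :=
  [set [set` (N :\: kappa F)%SET] | N in nested_set F].

Definition facial_building_set (S : finType) (M : orientedMatroid S)
  (F : {set lvFace M}) : Prop := building_set F.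

Definition facial_nested_complex (S : finType) (M : orientedMatroid S)
  (F : {set lvFace M}) : set (set (lvFace M)) := nested_complex F.

(* Isomorphism of abstract complexes, seen as families of subsets: a bijection
   between the sets of points covered by K and by K' which induces a bijection
   between K and K'. *)
Definition complex_iso (T U : Type) (K : set (set T)) (K' : set (set U)) :=
  exists f : T -> U,
    set_inj (\bigcup_(s in K) s) f /\ [set f @` s | s in K] = K'.

End Complexes.

(** * Polytopes *)

Section Polytopes.
Local Open Scope classical_set_scope.
Context {R : realType} {d : nat}.
Implicit Types (P Q F G X : set 'rV[R]_d) (a v o : 'rV[R]_d) (b : R).

Definition dot (u v : 'rV[R]_d) : R := \sum_(i < d) u 0 i * v 0 i.

Definition halfspace a b : set 'rV[R]_d := [set x | dot a x <= b].
Definition hyperplane a b : set 'rV[R]_d := [set x | dot a x = b].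

Definition conv_hull X : set 'rV[R]_d := smallest (@convex_set R 'rV[R]_d) X.

Definition aff_hull X : set 'rV[R]_d :=
  [set x | exists n (c : 'I_n -> R) (p : 'I_n -> 'rV[R]_d),
     [/\ forall i, X (p i), \sum_i c i = 1 & x = \sum_i c i *: p i]].

Definition relint X : set 'rV[R]_d :=
  [set x | aff_hull X x /\ \forall y \near x, aff_hull X y -> X y].

Definition polytope P := exists2 X, finite_set X & P = conv_hull X.

Definition supports P F a b :=
  P `<=` halfspace a b /\ F = P `&` hyperplane a b.

Definition face P F := exists a b, supports P F a b.

(* The empty face is proper (unless P is empty). *)
Definition proper_face P F := face P F /\ F <> P.

Definition facet P G :=
  proper_face P G /\ forall F, proper_face P F -> G `<=` F -> F = G.

Definition vertices P : set 'rV[R]_d := [set v | face P [set v]].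

(* Faces are recorded by their vertex sets. *)
Definition boundary_complex P : set (set 'rV[R]_d) :=
  [set vertices F | F in proper_face P].

(* For v in the affine span of P and G a facet of P, the choice of the
   inequality defining G is irrelevant. *)
Definition beyond P G v := exists a b, supports P G a b /\ b < dot a v.
Definition beneath P G v := exists a b, supports P G a b /\ dot a v < b.

Definition stellar_subdivision_at P F P' :=
  exists v, [/\ aff_hull P v,
    forall G, facet P G -> F `<=` G -> beyond P G v,
    forall G, facet P G -> ~ F `<=` G -> beneath P G v
  & P' = conv_hull (P `|` [set v])].

Definition stellar_subdivision P P' :=
  exists F, [/\ proper_face P F, F !=set0 & stellar_subdivision_at P F P'].

Definition truncation_at Q G Q' :=
  exists a b, [/\ G `&` halfspace a b = set0,
    forall v, vertices Q v -> ~ G v -> dot a v < b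
  & Q' = Q `&` halfspace a b].

Definition face_truncation Q Q' :=
  exists G, [/\ proper_face Q G, G !=set0 & truncation_at Q G Q'].

(* Polar of P with origin o, within the affine span of P; the dual of the
   affine span is identified with it through the dot product. *)
Definition polar o P : set 'rV[R]_d :=
  [set y | aff_hull P y /\ forall x, P x -> dot (x - o) (y - o) <= 1].

End Polytopes.

(** * The oriented matroid of a vector configuration *)

Section Realizable.
Context {R : realType} {n : nat}.
Variable A : {fset 'rV[R]_n}.

Definition evaluation_signs (w : 'rV[R]_n) : {set A} * {set A} :=
  ([set a : A | 0 < dot w (val a)], [set a : A | dot w (val a) < 0])%SET.

Definition evaluation_covectors : {set {set A} * {set A}} :=
  [set X | `[< exists w, X = evaluation_signs w >]]%SET.

Lemma evaluation_covectorP X :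
  reflect (exists w, X = evaluation_signs w) (X \in evaluation_covectors).
Proof. by rewrite finset.inE; apply: asboolP. Qed.

Lemma dot0l (x : 'rV[R]_n) : dot 0 x = 0.
Proof. by rewrite /dot big1// => i _; rewrite mxE mul0r. Qed.

Lemma dotDl (u v x : 'rV[R]_n) : dot (u + v) x = dot u x + dot v x.
Proof. by rewrite /dot -big_split; apply: eq_bigr => i _; rewrite mxE mulrDl. Qed.

Lemma dotZl (c : R) (u x : 'rV[R]_n) : dot (c *: u) x = c * dot u x.
Proof. by rewrite /dot mulr_sumr; apply: eq_bigr => i _; rewrite mxE mulrA. Qed.

Lemma dotNl (u x : 'rV[R]_n) : dot (- u) x = - dot u x.
Proof. by rewrite -scaleN1r dotZl mulN1r. Qed.

Fact evaluation_disj X : X \in evaluation_covectors -> [disjoint X.1 & X.2].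
Proof.
move=> /evaluation_covectorP[w ->]; rewrite -finset.setI_eq0 /=.
by apply/eqP/setP => a; rewrite !finset.inE; case: ltgtP.
Qed.

Fact evaluation0 : (finset.set0, finset.set0) \in evaluation_covectors.
Proof.
apply/evaluation_covectorP; exists 0.
by congr pair; apply/setP => a; rewrite !finset.inE dot0l ltxx.
Qed.

Fact evaluationN X :
  X \in evaluation_covectors -> signed_opp X \in evaluation_covectors.
Proof.
move=> /evaluation_covectorP[w ->]; apply/evaluation_covectorP; exists (- w).
by congr pair; apply/setP => a; rewrite !finset.inE dotNl ?oppr_gt0 ?oppr_lt0.
Qed.

Fact evaluation_comp X Y : X \in evaluation_covectors ->
  Y \in evaluation_covectors -> signed_comp X Y \in evaluation_covectors.
Proof.
move=> /evaluation_covectorP[u ->] /evaluation_covectorP[v ->].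
have [e e0 he] : exists2 e : R, 0 < e &
    forall a : A, dot u (val a) != 0 -> e * `|dot v (val a)| < `|dot u (val a)|.
  pose q (a : A) := `|dot u (val a)| / (1 + `|dot v (val a)|).
  have p1 (a : A) : 0 < 1 + `|dot v (val a)| by rewrite ltr_wpDr.
  exists (\big[Order.min/1]_(a | dot u (val a) != 0) q a).
    elim/big_ind: _ => // [x y x0 y0|a ua]; first by rewrite lt_min x0 y0.
    by rewrite divr_gt0// normr_gt0.
  move=> a ua; set e := \big[_/_]_(_ | _) _.
  have eq : e <= q a by rewrite /e (bigD1 a)//= ge_min lexx.
  have : e * (1 + `|dot v (val a)|) <= `|dot u (val a)|.
    by rewrite -ler_pdivlMr.
  apply: lt_le_trans; rewrite mulrDr mulr1 ltrDr.
  rewrite /e; elim/big_ind: _ => // [x y x0 y0|b ub]; first by rewrite lt_min x0 y0.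
  by rewrite divr_gt0// normr_gt0.
apply/evaluation_covectorP; exists (u + e *: v).
congr pair; apply/setP => a; rewrite !finset.inE dotDl dotZl.
- have := he a; set x := dot u _; set y := dot v _.
  have [x0|x0|->] := ltgtP x 0 => /=; last by rewrite add0r pmulr_rgt0.
    move=> /(_ isT); rewrite (ltr0_norm x0) => h; apply/esym/negbTE.
    rewrite -leNgt; apply: ltW; rewrite addrC -ltrBrDr sub0r.
    by apply: le_lt_trans h; rewrite ler_wpM2l ?ler_norm// ltW.
  move=> /(_ isT); rewrite (gtr0_norm x0) => h; apply/esym.
  rewrite -ltrBlDr sub0r -mulrN; apply: le_lt_trans h.
  by rewrite ler_wpM2l ?(ltW e0)// -normrN ler_norm.
- have := he a; set x := dot u _; set y := dot v _.
  have [x0|x0|->] := ltgtP x 0 => /=; last by rewrite add0r pmulr_rlt0.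
    move=> /(_ isT); rewrite (ltr0_norm x0) => h; apply/esym.
    rewrite addrC -ltrBrDr sub0r.
    by apply: le_lt_trans h; rewrite ler_wpM2l ?ler_norm// ltW.
  move=> /(_ isT); rewrite (gtr0_norm x0) => h; apply/esym/negbTE.
  rewrite -leNgt; apply: ltW; rewrite -ltrBlDr sub0r -mulrN.
  by apply: le_lt_trans h; rewrite ler_wpM2l ?(ltW e0)// -normrN ler_norm.
Qed.

Fact evaluation_elim X Y e :
  X \in evaluation_covectors -> Y \in evaluation_covectors ->
  e \in signed_sep X Y ->
  exists Z, [/\ Z \in evaluation_covectors, e \notin Z.1 :|: Z.2,
      Z.1 :\: signed_sep X Y = (signed_comp X Y).1 :\: signed_sep X Y
    & Z.2 :\: signed_sep X Y = (signed_comp X Y).2 :\: signed_sep X Y].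
Proof.
move=> /evaluation_covectorP[u ->] /evaluation_covectorP[v ->] he.
pose p : R := `|dot v (val e)|; pose q : R := `|dot u (val e)|.
have [p0 q0 pq] : [/\ 0 < p, 0 < q & p * dot u (val e) + q * dot v (val e) = 0].
  move: he; rewrite !finset.inE /p /q => /orP[] /andP[h1 h2].
  - rewrite (gtr0_norm h1) (ltr0_norm h2) oppr_gt0; split=> //.
    by rewrite mulNr mulrC addNr.
  - rewrite (gtr0_norm h2) (ltr0_norm h1) oppr_gt0; split=> //.
    by rewrite mulNr mulrC subrr.
exists (evaluation_signs (p *: u + q *: v)); split.
- by apply/evaluation_covectorP; exists (p *: u + q *: v).
- by rewrite !finset.inE dotDl !dotZl pq ltxx.
- apply/setP => a; rewrite !finset.inE dotDl !dotZl.
  set x := dot u _; set y := dot v _.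
  have [x0|x0|->] := ltgtP x 0; have [y0|y0|->] := ltgtP y 0 => //=;
    rewrite ?mulr0 ?addr0 ?add0r ?pmulr_rgt0// ?ltxx//.
  + by rewrite lt_gtF// -[ltRHS]addr0 ltrD// pmulr_rlt0.
  + by rewrite lt_gtF.
  + by rewrite addr_gt0// pmulr_rgt0.
  + by rewrite lt_gtF.
- apply/setP => a; rewrite !finset.inE dotDl !dotZl.
  set x := dot u _; set y := dot v _.
  have [x0|x0|->] := ltgtP x 0; have [y0|y0|->] := ltgtP y 0 => //=;
    rewrite ?mulr0 ?addr0 ?add0r ?pmulr_rlt0// ?ltxx//.
  + by rewrite -[ltRHS]addr0 ltrD// pmulr_rlt0.
  + by rewrite lt_gtF// addr_gt0// pmulr_rgt0.
  + by rewrite lt_gtF.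
  + by rewrite lt_gtF.
Qed.

Definition config_matroid : orientedMatroid A :=
  OrientedMatroid evaluation_disj evaluation0 evaluationN evaluation_comp
    evaluation_elim.

End Realizable.

(** * The homogenized vertex configuration of a polytope *)

Section Homogenized.
Local Open Scope classical_set_scope.
Context {R : realType} {d : nat}.
Implicit Type P : set 'rV[R]_d.

Definition homogenize (v : 'rV[R]_d) : 'rV[R]_(d + 1) := row_mx v (const_mx 1).

Definition homogenized_vertices P : {fset 'rV[R]_(d + 1)} :=
  fset_set [set homogenize v | v in vertices P].

Definition polytope_matroid P := config_matroid (homogenized_vertices P).

Lemma polytope_matroid_acyclic P : acyclic (polytope_matroid P).
Proof.
apply/evaluation_covectorP; exists (row_mx 0 (const_mx 1)).
suff h (a : homogenized_vertices P) : dot (row_mx 0 (const_mx 1)) (val a) = 1.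
  by congr pair; apply/setP => a; rewrite !finset.inE h ?ltr01 ?ltr10.
case: a => a /= ; rewrite /homogenized_vertices /fset_set.
case: pselect => // hf; case: cid => s /= hs ha.
have : [set` s] a by [].
rewrite -hs => -[v _ <-]; rewrite /dot big_split_ord /= big1 ?add0r.
  by rewrite big_ord1 !row_mxEr !mxE mulr1.
by move=> i _; rewrite row_mxEl mxE mul0r.
Qed.

End Homogenized.

(* Main.v *)
Require Import Defs.
From mathcomp Require Import all_boot all_order all_algebra finmap.
From mathcomp Require Import all_classical all_reals all_analysis.
From mathcomp Require Import ring lra.

Set Implicit Arguments.
Unset Strict Implicit.
Unset Printing Implicit Defensive.

Import Order.TTheory GRing.Theory Num.Theory.
Import numFieldNormedType.Exports.

(** Let [o] be the barycenter of the vertices of [P], and suppose first that the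
    only maximal element of the building set [F] is the whole of [P].  The
    realizing polytope can be written down at once.  For each other face [B] in
    [F], with barycenter [c_B], lift [c_B] to
      [v_B = o + (c_B - o) / (1 - delta B)],
    where [delta] is positive and decreases fast: [delta C <= eta * delta B] when
    [C < B], for a small [eta].  The polytope is the convex hull of [o] and these
    points, and [o] lies on none of its proper faces.
    Homogenize, and scale an inequality valid for all [v_B] so that the
    corresponding linear functional [u] takes the value [-1] at [o].  Validity
    then reads [u(c_B) <= - delta B], with equality when the inequality is tight
    at [v_B].  So the theorem comes down to: the sets of tight [B] are the nested
    sets ([nested_functional]).

    A tight set is nested ([nested_of_functional]).  Let incomparable [B_1], ...,
    [B_k] be tight and have a join [C] in [F].  By Farkas' lemma the sum of the
    [c_(B_i)] is a positive multiple of [c_C] plus a point of the cone of the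
    vertices ([join_weight]), and [u] is negative on vertices; hence
    [sum_i delta B_i >= e * delta C] for a constant [e > 0], which contradicts
    the fast decrease.

    A nested set [N] is tight ([functional_of_nested]).  The functional is built
    by recursion on the members of [N].  The maximal members of [N] below [B]
    are the factors of their join [Y] in the building set ([factors_join]), and
    the face [Y] is a product.  Geometrically this means that the spans of the
    factors are independent ([factors_independent]), so the functionals known on
    them glue to one on [Y] whose values are tiny compared with [delta B].
    Subtracting from an extension of it a multiple of a functional exposing [Y]
    makes the inequality tight at [B] and strict at the members of [F] that lie
    below [B] but not below [Y].

    When [F] has several maximal elements, they are the factors of the whole of
    [P], and the same functionals, now with value [-1] at the barycenters of all
    of them, describe the faces of a polytope in the quotient by these
    barycenters ([realize_quotient]).

    The subdivisions come from adding the points [v_B] one at a time, larger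
    faces first ([subdivision_chain]).  When [v_B] is added, [B] is still a
    face, as all the points added before lie off a hyperplane exposing it.  An
    inequality exposing a proper face that contains [B] is violated by [v_B]
    whatever [delta B] is; the inequalities of the finitely many facets that do
    not contain [B] remain valid as soon as [delta B] is small, and this can be
    combined with the fast decrease because [delta B] is chosen after the values
    of [delta] for the preceding faces.  On the polar side the new point is a halfspace which cuts off the face dual to
    [B] ([stellar_step]): a vertex of the polar is determined by the set of
    vertices of the polytope at which its inequality is tight ([polar_vertex]),
    so the same finitely many facets control all vertices of the polar, for every
    choice of the origin. *)

(** * Linear functionals and Farkas' lemma *)

Section LinearAlgebra.
Local Open Scope ring_scope.
Context {R : realType}.

Section Dot.
Context {n : nat}.
Implicit Types u v w x : 'rV[R]_n.

Lemma dotC u v : dot u v = dot v u.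
Proof. by apply: eq_bigr => i _; rewrite mulrC. Qed.

Lemma dotDr u x y : dot u (x + y) = dot u x + dot u y.
Proof. by rewrite !(dotC u) dotDl. Qed.

Lemma dotZr (c : R) u x : dot u (c *: x) = c * dot u x.
Proof. by rewrite !(dotC u) dotZl. Qed.

Lemma dotNr u x : dot u (- x) = - dot u x.
Proof. by rewrite !(dotC u) dotNl. Qed.

Lemma dotBr u x y : dot u (x - y) = dot u x - dot u y.
Proof. by rewrite dotDr dotNr. Qed.

Lemma dotBl u v x : dot (u - v) x = dot u x - dot v x.
Proof. by rewrite dotDl dotNl. Qed.

Lemma dot0r u : dot u 0 = 0.
Proof. by rewrite dotC dot0l. Qed.

Lemma dot_sumr (I : finType) (P : pred I) u (f : I -> 'rV[R]_n) :
  dot u (\sum_(i | P i) f i) = \sum_(i | P i) dot u (f i).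
Proof. exact: (big_morph (dot u) (dotDr u) (dot0r u)). Qed.

Lemma dot_comb (I : finType) (P : pred I) u (c : I -> R) (f : I -> 'rV[R]_n) :
  dot u (\sum_(i | P i) c i *: f i) = \sum_(i | P i) c i * dot u (f i).
Proof. by rewrite dot_sumr; apply: eq_bigr => i _; rewrite dotZr. Qed.

Lemma dot_ge0 u : 0 <= dot u u.
Proof. by apply: sumr_ge0 => i _; rewrite -expr2 sqr_ge0. Qed.

Lemma dot_eq0 u : (dot u u == 0) = (u == 0).
Proof.
apply/idP/eqP => [|->]; last by rewrite dot0l.
rewrite psumr_eq0 => [/allP h|i _]; last by rewrite -expr2 sqr_ge0.
apply/rowP => i; have := h i (mem_index_enum _).
by rewrite mulf_eq0 orbb mxE => /eqP.
Qed.

Lemma dot_mx u x : u *m x^T = (dot u x)%:M.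
Proof.
apply/matrixP => i j; rewrite !ord1 !mxE eqxx mulr1n.
by apply: eq_bigr => k _; rewrite !mxE.
Qed.

Lemma dot_homogenize (w : 'rV[R]_(n + 1)) x :
  dot w (homogenize x) = dot (lsubmx w) x + rsubmx w 0 0.
Proof.
rewrite -{1}(hsubmxK w) /dot big_split_ord /= big_ord1.
rewrite !row_mxEr [const_mx _ _ _]mxE mulr1; congr (_ + _).
by apply: eq_bigr => i _; rewrite !row_mxEl.
Qed.

Lemma dot_row_homogenize (a : 'rV[R]_n) (b : R) x :
  dot (row_mx a (const_mx b)) (homogenize x) = dot a x + b.
Proof. by rewrite dot_homogenize row_mxKl row_mxKr mxE. Qed.

End Dot.

(** Bartl's induction: if a functional [w] separates all generators but the
    last one, [q], from [b], project everything along [q] onto the kernel of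
    [w] and use the induction hypothesis there. *)
Lemma farkas_set n (I : finType) (A : {set I}) (p : I -> 'rV[R]_n) (b : 'rV[R]_n) :
  (exists2 mu : I -> R, forall i, 0 <= mu i & b = \sum_(i in A) mu i *: p i) \/
  (exists2 w, forall i, i \in A -> 0 <= dot w (p i) & dot w b < 0).
Proof.
have [m] := ubnP #|A|; elim: m => // m IH in A p b *; rewrite ltnS => Am.
have [A0|[k kA]] := finset.set_0Vmem A.
  have [->|b0] := eqVneq b 0.
    by left; exists (fun=> 0) => //; rewrite A0 big_set0.
  right; exists (- b) => [i|]; first by rewrite A0 finset.inE.
  by rewrite dotNl oppr_lt0 lt_neqAle dot_ge0 eq_sym dot_eq0 b0.
have Ak : (#|A :\ k|%SET < m)%N by move: Am; rewrite (cardsD1 k) kA.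
have sumk (f : I -> 'rV[R]_n) :
    \sum_(i in A) f i = f k + \sum_(i in (A :\ k)%SET) f i by rewrite (big_setD1 k).
have [[mu mu0 bE]|[w w0 wb]] := IH _ p b Ak.
  left; exists (fun i => if i == k then 0 else mu i) => [i|].
    by case: ifP.
  rewrite sumk eqxx scale0r add0r bE; apply: eq_bigr => i.
  by rewrite !finset.inE => /andP[/negbTE-> _].
have [q0|q0] := leP 0 (dot w (p k)).
  right; exists w => // i iA; have [->//|ik] := eqVneq i k.
  by apply: w0; rewrite !finset.inE ik.
pose r := (dot w (p k))^-1.
have r0 : r < 0 by rewrite invr_lt0.
have [] := IH _ (fun i => p i - (dot w (p i) * r) *: p k)
  (b - (dot w b * r) *: p k) Ak.
- move=> [mu mu0 bE]; left.
  exists (fun i => if i == k then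
     dot w b * r - \sum_(j in (A :\ k)%SET) mu j * (dot w (p j) * r) else mu i).
    move=> i; case: ifP => // _; rewrite subr_ge0.
    apply: (@le_trans _ _ 0); last by rewrite mulr_le0// ltW.
    apply: sumr_le0 => j jA; rewrite mulr_ge0_le0 => //.
    by rewrite mulr_ge0_le0 ?w0// ltW.
  rewrite sumk eqxx -[LHS](subrK ((dot w b * r) *: p k)) bE scalerBl.
  rewrite addrC -addrA; congr (_ + _); rewrite scaler_suml -sumrN -big_split /=.
  apply: eq_bigr => i; rewrite !finset.inE => /andP[/negbTE-> _].
  by rewrite scalerBr scalerA addrC.
- move=> [w' w'0 w'b]; right; exists (w' - (dot w' (p k) * r) *: w) => [i iA|].
    rewrite dotBl dotZl; have [->|ik] := eqVneq i k.
      by rewrite /r mulfVK ?subrr// lt_eqF.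
    have := w'0 i; rewrite !finset.inE ik => /(_ iA); rewrite dotBr dotZr.
    by congr (_ <= _ - _); ring.
  by move: w'b; rewrite dotBr dotZr dotBl dotZl; congr (_ - _ < _); ring.
Qed.

Lemma farkas n (I : finType) (p : I -> 'rV[R]_n) (b : 'rV[R]_n) :
  (exists2 mu : I -> R, forall i, 0 <= mu i & b = \sum_i mu i *: p i) \/
  (exists2 w, forall i, 0 <= dot w (p i) & dot w b < 0).
Proof.
have [[mu m0 E]|[w w0 wb]] := farkas_set finset.setT p b.
  by left; exists mu => //; rewrite E; apply: eq_bigl => i; rewrite finset.inE.
by right; exists w => // i; apply: w0; rewrite finset.inE.
Qed.

Lemma fin_lower (T : finType) (Q : pred T) (f : T -> R) :
  (forall x, Q x -> 0 < f x) -> exists2 e, 0 < e & forall x, Q x -> e <= f x.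
Proof.
move=> f0; exists (\big[Order.min/1]_(x | Q x) f x).
  by elim/big_ind: _ => // x y x0 y0; rewrite lt_min x0 y0.
by move=> x Qx; rewrite (bigD1 x)//= ge_min lexx.
Qed.

Lemma fin_upper (T : finType) (f : T -> R) :
  exists2 e, 1 <= e & forall x, f x <= e.
Proof.
exists (1 + \sum_x `|f x|); first by rewrite lerDl sumr_ge0.
move=> x; rewrite (bigD1 x)//= addrA ler_wpDr ?sumr_ge0//.
by rewrite ler_wpDl// ler_norm.
Qed.

(** The column space of a matrix consists of the columns that are killed by all
    the linear relations between its rows. *)
Lemma functional_of_values n (I : finType) (Y : {set I}) (p : I -> 'rV[R]_n)
    (f : I -> R) :
  (forall r : I -> R, \sum_(i in Y) r i *: p i = 0 -> \sum_(i in Y) r i * f i = 0) ->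
  exists u, forall i, i \in Y -> dot u (p i) = f i.
Proof.
move=> h.
pose q i : 'rV[R]_n := if i \in Y then p i else 0.
pose g i : R := if i \in Y then f i else 0.
pose M := \matrix_(i < #|I|) q (enum_val i).
pose c : 'rV[R]_#|I| := \row_i g (enum_val i).
suff /submxP[D cE] : (c <= M^T)%MS.
  exists D => i iY; have := congr1 (fun v : 'rV_ _ => v 0 (enum_rank i)) cE.
  rewrite /c !mxE enum_rankK /g iY => ->; rewrite /dot; apply: eq_bigr => j _.
  by rewrite !mxE enum_rankK /q iY.
rewrite submxE; apply/eqP/rowP => j; rewrite !mxE.
pose r i := cokermx M^T (enum_rank i) j.
have := h r; have sumE (V : zmodType) (G : I -> V) :
   (forall i, i \notin Y -> G i = 0) -> \sum_(i < #|I|) G (enum_val i) = \sum_(i in Y) G i.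
  move=> G0; rewrite [RHS]big_mkcond (reindex (fun i : 'I_#|I| => enum_val i)) /=; last first.
    by apply: onW_bij; exists enum_rank; [exact: enum_valK|exact: enum_rankK].
  by apply: eq_bigr => i _; case: ifPn => // /G0.
have -> : \sum_(i in Y) r i *: p i = 0.
  transitivity (\sum_(i in Y) r i *: q i).
    by apply: eq_bigr => i iY; rewrite /q iY.
  rewrite -(sumE _ (fun i => r i *: q i)) => [|i iY]; last first.
    by rewrite /q (negbTE iY) scaler0.
  apply/rowP => k; have /matrixP/(_ k j) := mulmx_coker M^T.
  rewrite mxE [in RHS]mxE summxE => E; rewrite [RHS]mxE -[RHS]E.
  by apply: eq_bigr => i _; rewrite mxE /r enum_valK mulrC !mxE.
move=> /(_ erefl) E; rewrite -[RHS]E.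
transitivity (\sum_(i < #|I|) r (enum_val i) * g (enum_val i)).
  by apply: eq_bigr => i _; rewrite [c _ _]mxE /r enum_valK mulrC.
rewrite (sumE _ (fun i => r i * g i)) => [|i iY]; last by rewrite /g (negbTE iY) mulr0.
by apply: eq_bigr => i iY; rewrite /g iY.
Qed.

(** The values on [Y] can be prolonged along a fixed linear projection onto
    the span of [Y]; this gives a bound which depends only on [Y]. *)
Lemma bounded_extension n (I : finType) (Y : {set I}) (p : I -> 'rV[R]_n) :
  exists2 K : R, 1 <= K & forall (u : 'rV[R]_n) (e : R), 0 <= e ->
    (forall i, i \in Y -> `|dot u (p i)| <= e) ->
    exists2 v, forall i, i \in Y -> dot v (p i) = dot u (p i)
            & forall i, `|dot v (p i)| <= K * e.
Proof.
pose q i : 'rV[R]_n := if i \in Y then p i else 0.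
pose M := \matrix_(i < #|I|) q (enum_val i).
pose Pi := pinvmx M *m M.
pose c i : 'rV[R]_#|I| := p i *m pinvmx M.
exists (1 + \sum_i \sum_j `|c i 0 j|).
  by rewrite lerDl; apply: sumr_ge0 => i _; apply: sumr_ge0.
move=> u e e0 ue; pose v := (Pi *m u^T)^T.
have vE x : dot v x = dot u (x *m Pi).
  have /matrixP/(_ 0 0) : (dot v x)%:M = (dot u (x *m Pi))%:M :> 'M[R]_1.
    by rewrite (dotC u) (dotC v) -!dot_mx /v trmxK mulmxA.
  by rewrite !mxE eqxx !mulr1n.
exists v => i.
  move=> iY; rewrite vE /Pi mulmxA mulmxKpV//.
  have -> : p i = row (enum_rank i) M by rewrite rowK enum_rankK /q iY.
  exact: row_sub.
rewrite vE /Pi mulmxA -/(c i) mulmx_sum_row dot_comb.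
apply: (le_trans (ler_norm_sum _ _ _)); rewrite mulrDl mul1r.
apply: ler_wpDl => //; rewrite (bigD1 i)//= mulrDl; apply: ler_wpDr.
  by rewrite mulr_ge0// sumr_ge0// => k _; apply: sumr_ge0.
rewrite mulr_suml; apply: ler_sum => j _; rewrite normrM ler_wpM2l//.
rewrite rowK /q; case: ifPn => h; first exact: ue.
by rewrite dot0r normr0.
Qed.

Lemma dot_mulmx n (B : 'M[R]_n) (a u : 'rV[R]_n) : dot (a *m B^T) u = dot a (u *m B).
Proof.
have /matrixP/(_ 0 0) : (dot (a *m B^T) u)%:M = (dot a (u *m B))%:M :> 'M[R]_1.
  by rewrite -!dot_mx trmx_mul mulmxA.
by rewrite !mxE eqxx !mulr1n.
Qed.

(** The functionals vanishing on the [c i] are those that factor through the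
    quotient by their span; [B] realizes the quotient inside the space. *)
Lemma quotient_functional n m (c : 'I_m -> 'rV[R]_n) : exists B : 'M[R]_n,
  (forall i, c i *m B = 0) /\
  forall w, (forall i, dot w (c i) = 0) -> exists a, forall u, dot a (u *m B) = dot w u.
Proof.
pose U := \matrix_i c i; exists (cokermx U); split=> [i|w w0].
  have -> : c i = row i U by rewrite rowK.
  by rewrite -row_mul mulmx_coker; apply/rowP => j; rewrite !mxE.
have [r|a aE] := @functional_of_values n 'I_n [set: 'I_n]%SET
  (fun i => row i (cokermx U)) (fun i => w 0 i).
  have sT (V : nmodType) (f : 'I_n -> V) : \sum_(i in [set: 'I_n]%SET) f i = \sum_i f i.
    by apply: eq_bigl => i; rewrite finset.inE.
  rewrite !sT => E; pose v : 'rV[R]_n := \row_i r i.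
  have : (v <= U)%MS.
    rewrite submxE mulmx_sum_row; apply/eqP; rewrite -[RHS]E.
    by apply: eq_bigr => i _; rewrite mxE.
  move=> /submxP[D vE].
  have -> : \sum_i r i * w 0 i = dot w v.
    by apply: eq_bigr => i _; rewrite mxE mulrC.
  rewrite vE mulmx_sum_row dot_comb big1// => i _.
  by rewrite rowK w0 mulr0.
exists a => u; rewrite mulmx_sum_row dot_comb [RHS]/dot.
apply: eq_bigr => i _; have := aE i; rewrite finset.inE => /(_ isT) /= ->.
by rewrite mulrC.
Qed.

End LinearAlgebra.

(** * Building sets and their factors *)

Section NestedSets.
Local Open Scope classical_set_scope.

(** The nested complex in the form produced by [realize_complex]: the maximal
    elements of [F] are left out of the index set and put back in the condition. *)
Lemma nested_complexE (disp : Order.disp_t) (L : finTBLatticeType disp) (F : {set L}) :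
  nested_complex F = [set [set` N] | N in [set N : {set L} |
    N \subset (F :\: kappa F)%SET /\ nested_set F (N :|: kappa F)%SET]].
Proof.
apply/seteqP; split=> [_ [N hN <-]|_ [N [/fintype.subsetP ND hN] <-]].
  have [NF kN _] := hN; exists (N :\: kappa F)%SET => //; split; first exact: finset.setSD.
  suff -> : (N :\: kappa F :|: kappa F)%SET = N by [].
  apply/setP => B; rewrite finset.in_setU finset.in_setD.
  have [Bk|Bk] := boolP (B \in kappa F).
    by rewrite orbT (fintype.subsetP kN).
  by rewrite orbF.
exists (N :|: kappa F)%SET => //.
suff -> : ((N :|: kappa F) :\: kappa F)%SET = N by [].
apply/setP => B; rewrite finset.in_setD finset.in_setU.
by case: (boolP (B \in N)) => [/ND|_] /=; [rewrite finset.inE => /andP[-> _]|rewrite andNb].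
Qed.

Lemma nested_single (disp : Order.disp_t) (L : finTBLatticeType disp) (F : {set L}) B :
  B \in (F :\: kappa F)%SET -> nested_set F ([set B] :|: kappa F)%SET.
Proof.
move=> BD; split=> [||A' sub A1]; last first.
- suff : (#|A'| <= 1)%N by rewrite leqNgt A1.
  rewrite -(finset.cards1 B); apply/subset_leq_card/(fintype.subset_trans sub).
  apply/fintype.subsetP => C; rewrite finset.in_setD finset.in_setU => /andP[nk].
  by rewrite (negbTE nk) orbF.
- exact: finset.subsetUr.
- rewrite finset.subUset finset.sub1set; move: BD; rewrite finset.inE => /andP[_ ->] /=.
  by apply/fintype.subsetP => C; rewrite finset.inE => /andP[].
Qed.

End NestedSets.

Section Building.
Local Open Scope order_scope.
Context {S : finType} {M : orientedMatroid S}.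
Local Notation L := (lvFace M).
Implicit Types (a : S) (B C X Y Z : L) (F N K : {set L}).
Hypothesis face0 : lv_face M finset.set0.
Hypothesis face1 : forall a, lv_face M [set a]%SET.

Local Notation pt a := (LVFace (face1 a)).

Lemma mem_le a B C : a \in lv_set B -> B <= C -> a \in lv_set C.
Proof. by rewrite lv_leE => aB /fintype.subsetP; apply. Qed.

Lemma pt_le a B : (pt a <= B) = (a \in lv_set B).
Proof. by rewrite lv_leE finset.sub1set. Qed.

Lemma lv_set_bot : lv_set (\bot : L) = finset.set0.
Proof.
by apply/eqP; rewrite -finset.subset0; apply: (le0x (LVFace face0)).
Qed.

Lemma lt_botP B : reflect (exists a, a \in lv_set B) (\bot < B).
Proof.
rewrite lt0x; apply: (iffP idP) => [B0|[a aB]].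
  apply/finset.set0Pn; apply: contra B0 => /eqP B0.
  by apply/eqP/val_inj; rewrite /= B0 lv_set_bot.
by apply/eqP => B0; move: aB; rewrite B0 lv_set_bot finset.inE.
Qed.

Lemma le_pt X a : \bot < X -> X <= pt a -> X = pt a.
Proof.
move=> /lt_botP[b bX] Xa; apply: le_anti; rewrite Xa pt_le /=.
by move: (mem_le bX Xa); rewrite finset.inE => /eqP <-.
Qed.

Lemma max_elts_sub F B : B \in max_elts F -> B \in F.
Proof. by rewrite finset.inE => /andP[]. Qed.

Lemma max_elts_le F B C : B \in max_elts F -> C \in F -> B <= C -> C = B.
Proof.
by rewrite finset.inE => /andP[_ /forallP/(_ C)/implyP h] /h /implyP h' /h' /eqP.
Qed.

Lemma max_elts_incomparable F B C :
  B \in max_elts F -> C \in max_elts F -> B != C -> B >< C.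
Proof.
move=> BF CF; apply: contraNN => /orP[] h.
  by rewrite (max_elts_le BF (max_elts_sub CF) h).
by rewrite -(max_elts_le CF (max_elts_sub BF) h).
Qed.

Lemma le_max_elts F B : B \in F -> exists2 C, C \in max_elts F & B <= C.
Proof.
move=> BF.
have PB : (B \in F) && (B <= B) by rewrite BF lexx.
case: (arg_maxnP (P := fun C => (C \in F) && (B <= C)) (fun C => #|lv_set C|) PB)
  => C /andP[CF BC] Cmax.
exists C => //; rewrite finset.inE CF /=; apply/forallP => Z.
apply/implyP => ZF; apply/implyP => CZ.
have := Cmax Z; rewrite ZF (le_trans BC CZ) => /(_ isT) ZC.
by apply/eqP/val_inj/esym/eqP; rewrite eqEcard -lv_leE CZ.
Qed.

(** The elements named [B_1], ..., [B_k] in the definition of a building set. *)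
Definition factors F Y : {set L} := max_elts [set B in F | B <= Y]%SET.

Lemma factorsP F Y B : B \in factors F Y -> B \in F /\ B <= Y.
Proof. by move/max_elts_sub; rewrite finset.inE => /andP[]. Qed.

(** The atoms of a product of lattices are the atoms of its factors, and the
    elements of the product are the families of elements of the factors. *)
Lemma building_factors F Y : building_set F -> \bot < Y ->
  [/\ forall a, a \in lv_set Y -> exists2 B, B \in factors F Y & a \in lv_set B,
      forall B C a, B \in factors F Y -> C \in factors F Y ->
        a \in lv_set B -> a \in lv_set C -> B = C
    & forall f : L -> L, (forall B, B \in factors F Y -> f B <= B) ->
        lv_face M (\bigcup_(B in factors F Y) lv_set (f B))%SET].
Proof.
move=> [_ hF] Y0; have := hF Y Y0; rewrite /= -/(factors F Y).
set K := factors F Y; move=> [phi [[psi psiK phiK] phi_le phi_incl]].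
pose fam (f : L -> L) (fK : forall B, B \in K -> f B <= B)
  (j : {B | B \in K}) : below (val j) := exist _ (f (val j)) (fK _ (valP j)).
have oneK B X (BX : X <= B) C : C \in K -> (if C == B then X else \bot) <= C.
  by move=> _; case: eqP => [->|_] //; apply: le0x.
pose one B X (BX : X <= B) := fam (fun C => if C == B then X else \bot) (oneK B X BX).
have phi_one B X (BX : X <= B) : B \in K -> val (phi (one B X BX)) = X.
  move=> BK; have /= := phi_incl (exist _ B BK) (one B X BX).
  rewrite eqxx; apply=> i.
  by rewrite -val_eqE /= => /negbTE->.
have phi_ge x B (BK : B \in K) X : X <= val (x (exist _ B BK)) -> X <= val (phi x).
  move=> Xx; have XB : X <= B by apply: le_trans Xx (valP (x (exist _ B BK))).
  rewrite -[X in X <= _](phi_one B X XB BK); apply/phi_le => j /=.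
  case: eqP => [E|_]; last exact: le0x.
  by have -> : j = exist _ B BK by apply: val_inj.
have cover a : a \in lv_set Y -> exists2 B, B \in K & a \in lv_set B.
  move=> aY; have aY' : pt a <= Y by rewrite pt_le.
  pose x := psi (exist _ (pt a) aY').
  have xE : val (phi x) = pt a by rewrite /x phiK.
  have [/existsP[j xj]|] := boolP [exists j, val (x j) != \bot].
    exists (val j); first exact: valP.
    have : val (x j) = pt a.
      apply: le_pt; first by rewrite lt0x.
      by rewrite -xE; case: j xj => B BK xj; apply: (phi_ge x B BK).
    by move=> E; rewrite -pt_le -E; exact: (proj2_sig (x j)).
  rewrite negb_exists => /forallP x0.
  pose z := psi (exist _ (\bot) (le0x Y)).
  have : val (phi x) <= val (phi z).
    by apply/phi_le => j; move: (x0 j); rewrite negbK => /eqP->; apply: le0x.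
  by rewrite xE /z phiK pt_le lv_set_bot finset.inE.
split=> // [B C a BK CK aB aC|f fK].
  rewrite -pt_le in aB; rewrite -pt_le in aC.
  apply/eqP; apply: contraT => BC.
  have : phi (one B _ aB) = phi (one C _ aC) by apply: val_inj; rewrite !phi_one.
  move=> /(can_inj psiK) /(congr1 (fun x => val (x (exist _ B BK)))) /=.
  rewrite eqxx (negbTE BC) => /(congr1 (@lv_set _ _)) /= /setP /(_ a).
  by rewrite lv_set_bot !finset.inE eqxx.
have -> : (\bigcup_(B in K) lv_set (f B))%SET = lv_set (val (phi (fam f fK))).
  apply/setP => a; apply/finset.bigcupP/idP => [[B BK aB]|aZ].
    by rewrite -pt_le; apply: (phi_ge _ B BK); rewrite /= pt_le.
  have [B BK aB] := cover a (mem_le aZ (valP (phi (fam f fK)))).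
  exists B => //; rewrite -pt_le in aB; rewrite -pt_le in aZ; rewrite -pt_le.
  move: aZ; rewrite -[X in X <= _](phi_one B _ aB BK) => /phi_le.
  by move=> /(_ (exist _ B BK)) /=; rewrite eqxx.
exact: lv_faceP.
Qed.

(** A lower interval with two elements is a product in only one way. *)
Lemma building_pt F a : building_set F -> pt a \in F.
Proof.
move=> bF; have a0 : \bot < pt a by apply/lt_botP; exists a; rewrite finset.inE.
have [/(_ a) + _ _] := building_factors bF a0.
rewrite finset.inE eqxx => /(_ isT) [B /factorsP[BF Ba] aB].
by rewrite -(@le_pt B a)//; apply/lt_botP; exists a.
Qed.

(** The factors of the join of [N] group the elements of [N]; the
    join of each group is the whole factor, hence in [F], so that each group has
    one element. *)
Lemma factors_join F N : building_set F -> {subset N <= F} ->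
  (0 < #|N|)%N ->
  (forall A : {set L}, A \subset N -> (1 < #|A|)%N -> \join_(B in A) B \notin F) ->
  factors F (\join_(B in N) B) = N.
Proof.
move=> bF NF N0 hN; set Y := \join_(B in N) B.
have F0 B : B \in F -> \bot < B by case: bF => + _; apply.
have leY B : B \in N -> B <= Y by move=> BN; apply: (joins_sup (j := B)).
have Y0 : \bot < Y.
  have [B BN] := card_gt0P N0; apply: lt_le_trans (leY B BN).
  exact/F0/NF.
have [cov dis prd] := building_factors bF Y0.
set K := factors F Y in cov dis prd *.
have inK B : B \in N -> exists2 C, C \in K & B <= C.
  move=> BN; apply: le_max_elts.
  by rewrite finset.inE leY// andbT; apply: NF.
pose f C := \join_(B in [set B in N | B <= C]%SET) B.
have fle C : f C <= C by apply/joinsP => B; rewrite finset.inE => /andP[].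
have fE C : C \in K -> f C = C.
  move=> CK; apply: le_anti; rewrite fle /= lv_leE; apply/fintype.subsetP => a aC.
  have YU : Y <= LVFace (prd f (fun C _ => fle C)).
    apply/joinsP => B BN; have [Z ZK BZ] := inK B BN.
    rewrite lv_leE; apply/fintype.subsetP => b bB; apply/finset.bigcupP; exists Z => //.
    by apply: mem_le bB _; apply: (joins_sup (j := B)); rewrite finset.inE BN.
  have /finset.bigcupP[Z ZK aZ] := mem_le (mem_le aC (factorsP CK).2) YU.
  by rewrite (dis C Z a)// (mem_le aZ).
have grp C : C \in K -> [set B in N | B <= C]%SET = [set C]%SET.
  move=> CK; set G := [set B in N | B <= C]%SET.
  have CF := (factorsP CK).1.
  have : (#|G| <= 1)%N.
    rewrite leqNgt; apply/negP => /hN /negP; apply.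
      by apply/fintype.subsetP => B; rewrite finset.inE => /andP[].
    by rewrite -/(f C) fE.
  have [G0|[B BG] G1] := finset.set_0Vmem G.
    by have := F0 C CF; rewrite -(fE C CK) /f -/G G0 big_set0 ltxx.
  have GB : G = [set B]%SET.
    apply/esym/eqP; rewrite eqEcard finset.sub1set BG finset.cards1.
    exact: G1.
  by rewrite GB; congr [set _]%SET; rewrite -(fE C CK) /f -/G GB big_set1.
apply/setP => B; apply/idP/idP => [BK|BN].
  have : B \in [set B]%SET by rewrite finset.inE.
  by rewrite -(grp B BK) finset.inE => /andP[].
have [C CK BC] := inK B BN.
have : B \in [set B in N | B <= C]%SET by rewrite finset.inE BN.
by rewrite grp// finset.inE => /eqP->.
Qed.

End Building.

(** * Face functionals and the cone of a vector configuration *)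

Section Configuration.
Local Open Scope ring_scope.
Context {R : realType} {D : nat} (A : {fset 'rV[R]_D}).
Local Notation M := (config_matroid A).
Local Notation L := (lvFace M).
Implicit Types (a : A) (B C X Y Z : L) (u w x y : 'rV[R]_D).

Lemma config_faceP (X : {set A}) :
  reflect (exists w, (forall a, a \in X -> dot w (val a) = 0) /\
                     (forall a, a \notin X -> 0 < dot w (val a)))
          (lv_face M X).
Proof.
apply: (iffP idP) => [/evaluation_covectorP[w [E1 E2]]|[w [w0 w1]]].
  exists w; split=> a aX.
    have : a \notin [set b : A | 0 < dot w (val b)]%SET by rewrite -E1 finset.inE aX.
    have : a \notin [set b : A | dot w (val b) < 0]%SET by rewrite -E2 finset.inE.
    by rewrite !finset.inE; case: ltgtP.
  have : a \in (~: X)%SET by rewrite finset.inE.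
  by rewrite E1 finset.inE.
apply/evaluation_covectorP; exists w; congr pair; apply/setP => a;
  rewrite !finset.inE; case: (boolP (a \in X)) => aX.
- by rewrite w0// ltxx.
- by rewrite w1.
- by rewrite w0// ltxx.
- by rewrite lt_gtF// w1.
Qed.

Definition face_functional Y : 'rV[R]_D :=
  projT1 (cid (elimT (config_faceP _) (lv_faceP Y))).
Local Notation g := face_functional.

Lemma face_functional0 Y a : a \in lv_set Y -> dot (g Y) (val a) = 0.
Proof. by rewrite /g; case: cid => w /= [+ _]; apply. Qed.

Lemma face_functional_gt0 Y a : a \notin lv_set Y -> 0 < dot (g Y) (val a).
Proof. by rewrite /g; case: cid => w /= [_]; apply. Qed.

Lemma face_functional_ge0 Y a : 0 <= dot (g Y) (val a).
Proof.
by have [/face_functional0->|/face_functional_gt0/ltW] := boolP (a \in lv_set Y).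
Qed.

Definition barycenter B : 'rV[R]_D :=
  #|lv_set B|%:R^-1 *: \sum_(a in lv_set B) val a.
Local Notation c := barycenter.

Lemma dot_barycenter w B :
  dot w (c B) = #|lv_set B|%:R^-1 * \sum_(a in lv_set B) dot w (val a).
Proof. by rewrite dotZr dot_sumr. Qed.

Lemma dot_barycenter_le w B (e : R) : 0 <= e ->
  (forall a, a \in lv_set B -> dot w (val a) <= e) -> dot w (c B) <= e.
Proof.
move=> e0 le_e; rewrite dot_barycenter.
have [->|B0] := posnP #|lv_set B|; first by rewrite invr0 mul0r.
rewrite mulrC ler_pdivrMr ?ltr0n// mulr_natr -sumr_const.
exact: ler_sum.
Qed.

Lemma dot_barycenter_norm w B (e : R) : 0 <= e ->
  (forall a, a \in lv_set B -> `|dot w (val a)| <= e) -> `|dot w (c B)| <= e.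
Proof.
move=> e0 le_e; rewrite ler_norml lerNl -dotNl !dot_barycenter_le// => a aB.
  exact: le_trans (ler_norm _) (le_e a aB).
by rewrite dotNl (le_trans (ler_norm _))// normrN le_e.
Qed.

Lemma dot_barycenter_ge0 w B :
  (forall a, a \in lv_set B -> 0 <= dot w (val a)) -> 0 <= dot w (c B).
Proof. by move=> w0; rewrite dot_barycenter mulr_ge0 ?invr_ge0 ?sumr_ge0. Qed.

Lemma dot_barycenter_eq0 w B :
  (forall a, a \in lv_set B -> dot w (val a) = 0) -> dot w (c B) = 0.
Proof. by move=> w0; rewrite dot_barycenter big1 ?mulr0. Qed.

Lemma dot_barycenter_gt0 w B a :
  (forall a, a \in lv_set B -> 0 <= dot w (val a)) ->
  a \in lv_set B -> 0 < dot w (val a) -> 0 < dot w (c B).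
Proof.
move=> w0 aB wa; rewrite dot_barycenter mulr_gt0//.
  by rewrite invr_gt0 ltr0n (cardD1 a) aB.
by rewrite (bigD1 a)//= ltr_pwDl// sumr_ge0// => b /andP[bB _]; apply: w0.
Qed.

Lemma face_functional_barycenter Y B :
  ~~ (B <= Y)%O -> 0 < dot (g Y) (c B).
Proof.
move=> /fintype.subsetPn[a aB aY]; apply: (dot_barycenter_gt0 (a := a)) => //.
  by move=> b _; apply: face_functional_ge0.
exact: face_functional_gt0.
Qed.

(** The cone is that of all vectors of [A]; a point of it belongs to the cone of a
    face [X] when [g X] vanishes on it. *)
Definition in_cone x := exists2 mu : A -> R, forall a, 0 <= mu a & x = \sum_a mu a *: val a.

Lemma in_coneD x y : in_cone x -> in_cone y -> in_cone (x + y).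
Proof.
move=> [m m0 ->] [k k0 ->]; exists (fun a => m a + k a) => [a|].
  by rewrite addr_ge0.
by rewrite -big_split; apply: eq_bigr => a _; rewrite scalerDl.
Qed.

Lemma in_coneZ (t : R) x : 0 <= t -> in_cone x -> in_cone (t *: x).
Proof.
move=> t0 [m m0 ->]; exists (fun a => t * m a) => [a|]; first by rewrite mulr_ge0.
by rewrite scaler_sumr; apply: eq_bigr => a _; rewrite scalerA.
Qed.

Lemma in_cone_sum (Q : pred A) (mu : A -> R) :
  (forall a, 0 <= mu a) -> in_cone (\sum_(a | Q a) mu a *: val a).
Proof.
move=> m0; exists (fun a => if Q a then mu a else 0) => [a|]; first by case: ifP.
by rewrite big_mkcond; apply: eq_bigr => a _; case: ifP => // _; rewrite scale0r.
Qed.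

Lemma in_cone_gen a : in_cone (val a).
Proof.
exists (fun b => (b == a)%:R) => [b|]; first by rewrite ler0n.
rewrite (bigD1 a)//= eqxx scale1r big1 ?addr0// => b /negbTE->.
by rewrite scale0r.
Qed.

Lemma in_cone_barycenter B : in_cone (c B).
Proof.
apply: in_coneZ; first by rewrite invr_ge0.
have := @in_cone_sum (mem (lv_set B)) (fun=> 1) (fun=> ler01).
by under eq_bigr do rewrite scale1r.
Qed.

Lemma in_cone_dot_ge0 w x :
  (forall a, 0 <= dot w (val a)) -> in_cone x -> 0 <= dot w x.
Proof.
move=> w0 [m m0 ->]; rewrite dot_comb sumr_ge0// => a _.
by rewrite mulr_ge0.
Qed.

Lemma in_coneP x :
  in_cone x <-> forall w, (forall a, 0 <= dot w (val a)) -> 0 <= dot w x.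
Proof.
split=> [xc w w0|h]; first exact: in_cone_dot_ge0.
have [//|[w w0 wx]] := farkas (fun a : A => val a) x.
by have := h w w0; rewrite leNgt wx.
Qed.

Section Acyclic.
Context (h : 'rV[R]_D) (h1 : forall a, dot h (val a) = 1).

Lemma lv_face0 : lv_face M finset.set0.
Proof.
by apply/config_faceP; exists h; split=> a; rewrite finset.inE// h1.
Qed.

Lemma gt_bot B : ((\bot < B)%O) = (0 < #|lv_set B|)%N.
Proof. exact: (sameP (lt_botP lv_face0 B) card_gt0P). Qed.

Lemma height_barycenter B : (\bot < B)%O -> dot h (c B) = 1.
Proof.
rewrite gt_bot => B0; rewrite dot_barycenter (eq_bigr (fun=> 1)); last by move=> a _; apply: h1.
by rewrite sumr_const mulVf// pnatr_eq0 -lt0n.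
Qed.

(** If every nonnegative functional vanishing at [x] vanishes on [C], then some
    positive multiple of the barycenter of [C] can be split off from [x]:
    otherwise Farkas' lemma, applied to [- c C] and to the generators together
    with [- x], would give a nonnegative functional vanishing at [x] and positive
    at [c C]. *)
Lemma subtract_barycenter x C : in_cone x ->
  (forall w, (forall a, 0 <= dot w (val a)) -> dot w x = 0 ->
     forall a, a \in lv_set C -> dot w (val a) = 0) ->
  exists2 t : R, 0 < t & in_cone (x - t *: c C).
Proof.
move=> xc hw; have [C0|C0] := posnP #|lv_set C|.
  by exists 1 => //; rewrite /c C0 invr0 scale0r scaler0 subr0.
pose q (o : option A) := if o is Some a then val a else - x.
have [[mu mu0]|[w w0]] := farkas q (- c C); last first.
  have wx : dot w x = 0.
    apply/eqP; rewrite eq_le (in_cone_dot_ge0 _ xc) ?andbT//; last first.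
      by move=> a; have := w0 (Some a).
    by have := w0 None; rewrite dotNr oppr_ge0.
  rewrite dotNr oppr_lt0 dot_barycenter_eq0 ?ltxx// => a aC.
  by apply: hw wx _ aC => b; have := w0 (Some b).
rewrite (bigD1 None)//= scalerN => E.
pose y := \sum_(i | i != None) mu i *: q i.
have yc : in_cone y.
  rewrite /y; elim/big_ind: _ => //.
    by exists (fun=> 0) => //; rewrite big1// => a _; rewrite scale0r.
    exact: in_coneD.
  by case=> // a _; apply: in_coneZ => //; apply: in_cone_gen.
have xE : mu None *: x = y + c C by rewrite -[c C]opprK E -/y opprD opprK addrCA subrr addr0.
have m0 : 0 < mu None.
  rewrite lt_neqAle mu0 andbT eq_sym; apply/negP => /eqP m0.
  have := congr1 (dot h) xE; rewrite m0 scale0r dot0r dotDr height_barycenter ?gt_bot//.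
  have := in_cone_dot_ge0 (w := h) (fun a => eq_ind_r (fun z => 0 <= z) ler01 (h1 a)) yc.
  lra.
exists (mu None)^-1; first by rewrite invr_gt0.
have -> : x - (mu None)^-1 *: c C = (mu None)^-1 *: y.
  by rewrite -[x in LHS]scale1r -(mulVf (lt0r_neq0 m0)) -scalerA xE scalerDr addrK.
by apply: in_coneZ => //; rewrite invr_ge0 ltW.
Qed.

(** Moving from a point of a face [X] away from its barycenter, one leaves the
    cone through a proper face of [X]. *)
Lemma exit_face x X : in_cone x -> dot (g X) x = 0 -> (\bot < X)%O ->
  exists t Z, [/\ 0 <= t, (Z < X)%O, in_cone (x - t *: c X) & dot (g Z) (x - t *: c X) = 0].
Proof.
move=> xc gx X0.
(* the set of admissible [t] is bounded by [h], and closed as it is cut out by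
   the functionals nonnegative on the generators *)
have hx t : in_cone (x - t *: c X) -> t <= dot h x.
  move=> /(in_cone_dot_ge0 (w := h)); rewrite dotBr dotZr height_barycenter// mulr1 subr_ge0.
  by apply=> a; rewrite h1.
pose T : set R := fun t => in_cone (x - t *: c X).
have T0 : T 0 by rewrite /T /= scale0r subr0.
have Tsup : has_sup T by split; [exists 0|exists (dot h x) => t; apply: hx].
pose t := sup T.
have t0 : 0 <= t by apply: sup_ubound => //; case: Tsup.
have Tt : in_cone (x - t *: c X).
  apply/in_coneP => w w0; rewrite dotBr dotZr subr_ge0.
  have [cX|cX] := leP (dot w (c X)) 0.
    by apply: (@le_trans _ _ 0); [rewrite mulr_ge0_le0|apply: in_cone_dot_ge0].
  rewrite -ler_pdivlMr//; apply: sup_le_ub; first by exists 0.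
  move=> s /in_coneP/(_ w w0); rewrite dotBr dotZr subr_ge0.
  by rewrite ler_pdivlMr.
have gc : dot (g X) (c X) = 0.
  by apply: dot_barycenter_eq0 => a; apply: face_functional0.
(* at the supremum no further multiple of the barycenter can be subtracted, so
   some functional [w] vanishes at the exit point but not on the whole of [X] *)
have [hw|hw] := pselect (forall w, (forall a, 0 <= dot w (val a)) -> dot w (x - t *: c X) = 0 ->
     forall a, a \in lv_set X -> dot w (val a) = 0).
  have [e e0] := subtract_barycenter Tt hw.
  rewrite -addrA -opprD -scalerDl => Te.
  have : t + e <= t by apply: sup_ubound => //; case: Tsup.
  by rewrite gerDl leNgt e0.
move/existsNP: hw => [w /not_implyP[w0 /not_implyP[wx /existsNP[a]]]].
move=> /not_implyP[aX wa].
have Zf : lv_face M [set b in lv_set X | dot w (val b) == 0]%SET.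
  apply/config_faceP; exists (g X + w); split=> b; rewrite finset.inE dotDl.
    by move=> /andP[bX /eqP->]; rewrite face_functional0// addr0.
  rewrite negb_and; have [bX /= wb|bX _] := boolP (b \in lv_set X).
    by rewrite face_functional0// add0r lt_neqAle eq_sym wb w0.
  by rewrite ltr_pwDl// face_functional_gt0.
exists t, (LVFace Zf); split=> //.
  rewrite lt_neqAle; apply/andP; split; last first.
    by rewrite lv_leE; apply/fintype.subsetP => b; rewrite finset.inE => /andP[].
  apply/eqP => /(congr1 val)/= E; apply: wa.
  by move: aX; rewrite -E finset.inE => /andP[_ /eqP].
have [m m0 xE] := Tt.
have wg : dot w (x - t *: c X) + dot (g X) (x - t *: c X) = 0.
  by rewrite wx dotBr dotZr gc mulr0 gx subr0 addr0.
have ms a' : a' \notin lv_set (LVFace Zf) -> m a' = 0.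
  move=> na; move: wg; rewrite -dotDl {1}xE dot_comb => /eqP.
  have pos (b : A) : 0 <= dot (w + g X) (val b) by rewrite dotDl addr_ge0 ?w0 ?face_functional_ge0.
  rewrite psumr_eq0 => [/allP/(_ a' (mem_index_enum _))|b _]; last by rewrite mulr_ge0.
  rewrite mulf_eq0 => /orP[/eqP//|/=].
  rewrite dotDl paddr_eq0 ?w0 ?face_functional_ge0// => /andP[wb gb].
  case/negP: na; rewrite finset.inE wb andbT.
  by apply: contraTT gb => /face_functional_gt0 /lt0r_neq0.
rewrite xE dot_comb big1// => b _.
by have [/face_functional0->|/ms->] := boolP (b \in lv_set (LVFace Zf)); rewrite ?mulr0 ?mul0r.
Qed.

(** If [u] is in the span of [B], write [u = x - y] with [x] and [y] in the
    cone of [B] and subtract from both the largest common multiple of the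
    barycenter of [B].  One of them then lies in a proper face [X] of [B], hence
    so does the other, as [w] sees no difference between them; iterate. *)
Lemma span_vanish B (r : A -> R) :
  (forall X, (X < B)%O -> exists w,
     [/\ forall a, a \in lv_set X -> dot w (val a) = 0,
         forall a, a \in lv_set B -> a \notin lv_set X -> 0 < dot w (val a)
       & dot w (\sum_(a in lv_set B) r a *: val a) = 0]) ->
  \sum_(a in lv_set B) r a *: val a = 0.
Proof.
move=> hB; set u := \sum_(a in _) _.
suff main X x y : (X <= B)%O -> in_cone x -> in_cone y ->
    dot (g X) x = 0 -> dot (g X) y = 0 -> u = x - y -> u = 0.
  pose x := \sum_(a in lv_set B) Num.max (r a) 0 *: val a.
  pose y := \sum_(a in lv_set B) Num.max (- r a) 0 *: val a.
  apply: (main B x y) => //.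
  - by apply: in_cone_sum => a; rewrite le_max lexx orbT.
  - by apply: in_cone_sum => a; rewrite le_max lexx orbT.
  - by rewrite dot_comb big1// => a /face_functional0->; rewrite mulr0.
  - by rewrite dot_comb big1// => a /face_functional0->; rewrite mulr0.
  - rewrite /u /x /y -sumrB; apply: eq_bigr => a _; rewrite -scalerBl; congr (_ *: _).
    by rewrite !maxElt; case: (ltP (r a) 0); case: (ltP (- r a) 0); lra.
have [m] := ubnP #|lv_set X|; elim: m => // m IH in X x y *; rewrite ltnS => Xm XB xc yc gx gy uE.
have [X0|X0] := posnP #|lv_set X|.
  have z0 z : in_cone z -> dot (g X) z = 0 -> z = 0.
    move=> [k k0 ->]; rewrite dot_comb => /eqP.
    rewrite psumr_eq0 => [/allP kz|a _]; last by rewrite mulr_ge0 ?face_functional_ge0.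
    apply: big1 => a _; have := kz a (mem_index_enum _).
    rewrite mulf_eq0 => /orP[/eqP->|]; first by rewrite scale0r.
    rewrite gt_eqF// face_functional_gt0//.
    by apply/negP => aX; move: X0; rewrite (cardD1 a) aX.
  by rewrite uE (z0 x)// (z0 y)// subr0.
rewrite -gt_bot in X0.
have face_cone Z z : in_cone z -> (Z < X)%O -> dot (g X) z = 0 ->
    forall w, (forall a, a \in lv_set Z -> dot w (val a) = 0) ->
    (forall a, a \in lv_set B -> a \notin lv_set Z -> 0 < dot w (val a)) ->
    (dot w z = 0 <-> dot (g Z) z = 0).
  move=> [k k0 ->] ZX; rewrite dot_comb => /eqP.
  rewrite psumr_eq0 => [/allP kz|a _]; last by rewrite mulr_ge0 ?face_functional_ge0.
  have kX a : a \notin lv_set X -> k a = 0.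
    move=> aX; have := kz a (mem_index_enum _).
    by rewrite mulf_eq0 (gt_eqF (face_functional_gt0 aX)) orbF => /eqP.
  have sX a : a \in lv_set X -> a \in lv_set B.
    by apply/fintype.subsetP; rewrite -lv_leE.
  have sup0 w : (forall a, a \in lv_set Z -> dot w (val a) = 0) ->
    (forall a, a \in lv_set B -> a \notin lv_set Z -> 0 < dot w (val a)) ->
    (dot w (\sum_a k a *: val a) = 0 <-> forall a, a \notin lv_set Z -> k a = 0).
    move=> w0 w1; rewrite dot_comb; split=> [/eqP|kZ].
      rewrite psumr_eq0 => [/allP kw a aZ|a _].
        have [aX|/kX//] := boolP (a \in lv_set X).
        have := kw a (mem_index_enum _).
        by rewrite mulf_eq0 (gt_eqF (w1 _ (sX _ aX) aZ)) orbF => /eqP.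
      have [aX|/kX->] := boolP (a \in lv_set X); last by rewrite mul0r.
      have [aZ|aZ] := boolP (a \in lv_set Z); first by rewrite w0// mulr0.
      by rewrite mulr_ge0// ltW// w1// sX.
    apply: big1 => a _.
    by have [/w0->|/kZ->] := boolP (a \in lv_set Z); rewrite ?mulr0 ?mul0r.
  move=> w w0 w1; rewrite sup0// sup0// => a.
    exact: face_functional0.
  by move=> _; apply: face_functional_gt0.
have gc : dot (g X) (c X) = 0.
  by apply: dot_barycenter_eq0 => a; apply: face_functional0.
(* the smaller of the two exit times works for both points *)
have step x' y' t s Z : in_cone x' -> in_cone y' -> dot (g X) x' = 0 -> dot (g X) y' = 0 ->
    0 <= t -> t <= s -> (Z < X)%O -> in_cone (x' - t *: c X) ->
    dot (g Z) (x' - t *: c X) = 0 -> in_cone (y' - s *: c X) ->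
    (u = x' - y' \/ u = y' - x') -> u = 0.
  move=> xc' yc' gx' gy' t0 ts ZX xt gZ ys E.
  have yt : in_cone (y' - t *: c X).
    have -> : y' - t *: c X = (y' - s *: c X) + (s - t) *: c X.
      by rewrite scalerBl addrA subrK.
    by apply: in_coneD => //; apply: in_coneZ (in_cone_barycenter X); rewrite subr_ge0.
  have gt z : dot (g X) z = 0 -> dot (g X) (z - t *: c X) = 0.
    by move=> gz; rewrite dotBr dotZr gz gc mulr0 subr0.
  have [w [w0 w1 wu]] := hB Z (lt_le_trans ZX XB).
  have wxy : dot w (x' - t *: c X) = dot w (y' - t *: c X).
    case: E => E; move: wu; rewrite -/u E !dotBr; lra.
  have gZy : dot (g Z) (y' - t *: c X) = 0.
    apply/(face_cone _ _ yt ZX (gt _ gy') w w0 w1); rewrite -wxy.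
    exact/(face_cone _ _ xt ZX (gt _ gx') w w0 w1).
  have Zm : (#|lv_set Z| < m)%N.
    apply: leq_trans Xm; apply: proper_card; rewrite finset.properEneq -lv_leE (ltW ZX) andbT.
    by apply/eqP => /val_inj E'; move: ZX; rewrite E' ltxx.
  have ZB : (Z <= B)%O by apply: le_trans XB; apply: ltW.
  case: E => E.
    by apply: (IH Z _ _ Zm ZB xt yt gZ gZy); rewrite E opprB addrA subrK.
  by apply: (IH Z _ _ Zm ZB yt xt gZy gZ); rewrite E opprB addrA subrK.
have [t [Z [t0 ZX xt gZ]]] := exit_face xc gx X0.
have [s [W [s0 WX ys gW]]] := exit_face yc gy X0.
have [ts|/ltW st] := leP t s.
  by apply: (step x y t s Z) => //; left.
by apply: (step y x s t W) => //; right.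
Qed.

End Acyclic.
End Configuration.

(** * Nested sets as contact sets of linear functionals *)

Section Estimates.
Local Open Scope ring_scope.

(** With [E] the size of the extended functional and [m] the multiple of the
    face functional that is subtracted from it: the new functional has size
    [m0 * d], and is below [- eta * d] where the face functional is at least
    [gamma]. *)
Lemma descent_estimates (R : realFieldType) (K G gamma m0 eta d E vB gB m : R) :
  1 <= K -> 1 <= G -> 0 < gamma -> gamma <= 1 -> m0 = 1 + 2 * G / gamma ->
  0 < eta -> eta * (K * m0 + 1) * (4 * G) = gamma -> 0 < d ->
  E = K * (m0 * (eta * d)) -> `|vB| <= E -> gamma <= gB -> gB <= G ->
  m = (vB + d) / gB ->
  [/\ 0 < m, E + m * G <= m0 * d & E + eta * d < m * gamma].
Proof.
move=> K1 G1 gamma0 gamma1 m0E eta0 etaE d0 EE vBE gammaB gBG mdef.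
have G0 : 0 < G by apply: lt_le_trans G1.
have gB0 : 0 < gB by apply: lt_le_trans gammaB.
have E0 : 0 <= E by apply: le_trans vBE.
have Eeta : (E + eta * d) * (4 * G) = gamma * d by rewrite -[in RHS]etaE EE; ring.
have ed : 0 < eta * d by rewrite mulr_gt0.
have Ed : 4 * E <= d.
  have h1 : 4 * E <= E * (4 * G).
    by rewrite [E * _]mulrC ler_wpM2r//; clear -G1; lra.
  have h2 : gamma * d <= 1 * d by rewrite ler_wpM2r// ltW.
  have h3 : 0 < eta * d * (4 * G) by rewrite !mulr_gt0.
  move: h1 h2 h3 Eeta; clear; rewrite mulrDl; lra.
have mE : m * gB = vB + d by rewrite mdef divfK// gt_eqF.
move: vBE; rewrite ler_norml => /andP[vB1 vB2].
have m_gt0 : 0 < m by rewrite mdef divr_gt0//; clear -vB1 Ed E0 d0; lra.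
have m_ge : d <= 2 * m * G.
  have : m * gB <= m * G by rewrite ler_wpM2l// ltW.
  by rewrite mE -mulrA; clear -vB1 Ed E0 d0; lra.
have m_le : m * gamma <= 2 * d.
  have : m * gamma <= m * gB by rewrite ler_wpM2l// ltW.
  by rewrite mE; clear -vB2 Ed E0 d0; lra.
split=> //.
  have : m * G <= 2 * G / gamma * d.
    have -> : 2 * G / gamma * d = (2 * d) / gamma * G by ring.
    by rewrite ler_wpM2r ?(ltW G0)// ler_pdivlMr.
  by rewrite m0E mulrDl mul1r; clear -Ed E0 d0; lra.
rewrite -(ltr_pM2r (x := 4 * G)) ?mulr_gt0// Eeta.
have : gamma * d <= gamma * (2 * m * G) by rewrite ler_wpM2l// ltW.
have : 0 < m * gamma * G by rewrite !mulr_gt0.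
by clear; lra.
Qed.

End Estimates.

Section Core.
Local Open Scope ring_scope.
Context {R : realType} {D : nat} (A : {fset 'rV[R]_D}).
Local Notation M := (config_matroid A).
Local Notation L := (lvFace M).
Implicit Types (a : A) (B C X Y Z : L) (u w x y : 'rV[R]_D).
Context (h : 'rV[R]_D) (h1 : forall a, dot h (val a) = 1).
Context (face1 : forall a, lv_face M [set a]%SET).
Context (F : {set L}) (bF : building_set F).
Local Notation g := face_functional.
Local Notation c := barycenter.
Local Notation pt a := (LVFace (face1 a)).

Let face0 := lv_face0 h1.

Lemma barycenter_pt a : c (pt a) = val a.
Proof. by rewrite /c /= big_set1 cards1 invr1 scale1r. Qed.

(** Replacing one factor [B] by a face [X] of it and keeping the other factors
    gives a face of [Y].  The functional exposing that face sees, in a linear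
    relation on [Y], only the part carried by [B], so [span_vanish] applies. *)
Lemma factors_independent Y (r : A -> R) : (\bot < Y)%O ->
  \sum_(a in lv_set Y) r a *: val a = 0 ->
  forall B, B \in factors F Y -> \sum_(a in lv_set B) r a *: val a = 0.
Proof.
move=> Y0 rY B BK; have [cov dis prd] := building_factors face0 face1 bF Y0.
apply: (span_vanish h1) => X XB.
pose f C := if C == B then X else C.
have fle C : C \in factors F Y -> (f C <= C)%O.
  by move=> _; rewrite /f; case: eqP => // ->; apply: ltW.
pose Z : L := LVFace (prd f fle).
have inZ C a : C \in factors F Y -> a \in lv_set (f C) -> a \in lv_set Z.
  by move=> CK aC; apply/finset.bigcupP; exists C.
exists (g Z); split=> [a aX|a aB aX|].
- by apply/face_functional0/(inZ B) => //; rewrite /f eqxx.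
- apply: face_functional_gt0; apply/negP => /finset.bigcupP[C CK].
  rewrite /f; have [_|CB aC] := eqVneq C B; first by apply/negP.
  by move/eqP: CB; apply; apply: dis CK BK aC aB.
have := congr1 (dot (g Z)) rY; rewrite dot0r (bigID (mem (lv_set B))) /= dotDr.
rewrite [X in _ + X]dot_comb [X in _ + X]big1 ?addr0 => [|a /andP[aY aB]].
  move=> <-; congr dot; apply: eq_bigl => a; apply/idP/andP => [aB|[]//].
  by split=> //; apply: mem_le aB (factorsP BK).2.
have [C CK aC] := cov a aY; rewrite (face_functional0 (Y := Z)) ?mulr0//.
apply: (inZ C) => //; rewrite /f; case: eqP => // E.
by rewrite -E aC in aB.
Qed.

Lemma glue_functionals Y (al : L -> 'rV[R]_D) : exists u,
  forall C, C \in factors F Y -> forall a, a \in lv_set C -> dot u (val a) = dot (al C) (val a).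
Proof.
have bot C : C \in factors F Y -> (\bot < C)%O.
  by move=> /factorsP[CF _]; case: bF => + _; apply.
have [Y0|] := boolP (\bot < Y)%O; last first.
  rewrite lt0x negbK => /eqP Y0; exists 0 => C CK.
  have [_ CY] := factorsP CK.
  by have := lt_le_trans (bot C CK) CY; rewrite Y0 ltxx.
have [cov dis _] := building_factors face0 face1 bF Y0.
pose f a := \sum_(C in factors F Y | a \in lv_set C) dot (al C) (val a).
have fE C a : C \in factors F Y -> a \in lv_set C -> f a = dot (al C) (val a).
  move=> CK aC; rewrite /f (bigD1 C) ?CK//= big1 ?addr0// => B /andP[/andP[BK aB]].
  by rewrite (dis B C a)// eqxx.
have [|u uE] := @functional_of_values R D A (lv_set Y) (fun a => val a) f; last first.
  exists u => C CK a aC; rewrite uE; first exact: fE.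
  by apply: mem_le aC (factorsP CK).2.
move=> r /(factors_independent Y0) rC.
under eq_bigr do rewrite /f mulr_sumr.
rewrite (exchange_big_dep (mem (factors F Y))) /=; last by move=> a C _ /andP[].
apply: big1 => C CK; have := congr1 (dot (al C)) (rC C CK).
rewrite dot0r dot_comb => E; rewrite -[RHS]E; apply: eq_bigl => a.
rewrite CK /=; apply/andP/idP => [[]//|aC]; split=> //.
by apply: mem_le aC (factorsP CK).2.
Qed.

(** The depths of the lifted points: much smaller for smaller faces.  The value
    [1] on [kappa F] reflects the scaling of the functionals. *)
Definition hierarchy (eta : R) (delta : L -> R) :=
  [/\ forall K, K \in kappa F -> delta K = 1,
      forall B, B \in F -> 0 < delta B
    & forall B C, B \in F -> C \in F -> (C < B)%O -> delta C <= eta * delta B].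

Lemma hierarchy_le eta eta' delta : eta <= eta' -> hierarchy eta delta -> hierarchy eta' delta.
Proof.
move=> le [d1 d2 d3]; split=> // B C BF CF CB; apply: le_trans (d3 B C BF CF CB) _.
by rewrite ler_wpM2r// ltW// d2.
Qed.

(** A functional that vanishes at the sum of the barycenters exposes a face
    containing all the members of the family, hence their join. *)
Lemma join_weight : exists2 e : R, 0 < e & forall N : {set L},
  in_cone A (\sum_(B in N) c B - e *: c (\join_(B in N) B)%O).
Proof.
have ex (N : {set L}) : exists t : R,
    0 < t /\ in_cone A (\sum_(B in N) c B - t *: c (\join_(B in N) B)%O).
  have [||t t0 tc] := @subtract_barycenter R D A h h1 (\sum_(B in N) c B) (\join_(B in N) B)%O.
  - elim/big_ind: _ => [|x y|B _]; last exact: in_cone_barycenter.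
      by exists (fun=> 0) => //; rewrite big1// => a _; rewrite scale0r.
    exact: in_coneD.
  - move=> w w0; rewrite dot_sumr => /eqP.
    rewrite psumr_eq0 => [/allP wz|B _]; last exact: dot_barycenter_ge0.
    have Zf : lv_face M [set a | dot w (val a) == 0]%SET.
      apply/config_faceP; exists w; split=> a; rewrite finset.inE.
        by move/eqP.
      by rewrite lt_neqAle eq_sym w0 andbT.
    have NZ : (\join_(B in N) B <= LVFace Zf)%O.
      apply/joinsP => B BN; rewrite lv_leE; apply/fintype.subsetP => a aB.
      rewrite finset.inE; apply: contraT => wa.
      have := wz B (mem_index_enum _); rewrite BN /= gt_eqF//.
      apply: (dot_barycenter_gt0 (a := a)) => //.
      by rewrite lt_neqAle eq_sym wa w0.
    by move=> a aN; have := mem_le aN NZ; rewrite finset.inE => /eqP.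
  by exists t.
pose t N := projT1 (cid (ex N)).
have t0 N : 0 < t N by rewrite /t; case: cid => ? [].
have [e e0 et] := fin_lower (Q := predT) (fun N _ => t0 N).
exists e => // N.
set x := \sum_(B in N) _; set C := (\join_(B in N) B)%O.
have -> : x - e *: c C = (x - t N *: c C) + (t N - e) *: c C.
  by rewrite scalerBl addrA subrK.
apply: in_coneD; first by rewrite /t; case: cid => ? [].
by apply: in_coneZ (in_cone_barycenter C); rewrite subr_ge0 et.
Qed.

(** Splitting off the barycenter of a join [C] from the sum of the barycenters of
    the members shows that the depths of the members add up to at least a fixed
    fraction of [delta C], which the hierarchy excludes. *)
Lemma nested_of_functional : exists2 eta : R, 0 < eta &
  forall delta, hierarchy eta delta -> forall u,
    (forall B, B \in F -> dot u (c B) <= - delta B) ->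
    kappa F \subset [set B in F | dot u (c B) == - delta B]%SET ->
    nested_set F [set B in F | dot u (c B) == - delta B]%SET.
Proof.
have [e e0 ec] := join_weight.
exists (e / (#|{: L}|.+1%:R)); first by rewrite divr_gt0.
move=> delta [d1 d2 d3] u u_le kN; split=> //.
  by apply/fintype.subsetP => B; rewrite finset.inE => /andP[].
move=> N' N'N N'1 inc; apply/negP; set C := (\join_(B in N') B)%O => CF.
have u_neg a : dot u (val a) <= 0.
  rewrite -barycenter_pt (le_trans (u_le _ _)) ?oppr_le0 ?(ltW (d2 _ _))//;
  exact: (building_pt face0).
have inN B : B \in N' -> B \in F /\ dot u (c B) = - delta B.
  move=> /(fintype.subsetP N'N); rewrite !finset.inE => /andP[_ /andP[-> /eqP]].
  by [].
have ltC B : B \in N' -> (B < C)%O.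
  move=> BN; rewrite lt_neqAle (joins_sup (j := B))// andbT; apply/eqP => BC.
  have [B' B'N B'B] : exists2 B', B' \in N' & B' != B.
    move: N'1; rewrite (cardsD1 B) BN ltnS => /card_gt0P[B'].
    by rewrite !finset.inE => /andP[? ?]; exists B'.
  have := inc B' B B'N BN B'B; rewrite /Order.comparable {1}BC.
  by rewrite (joins_sup (j := B')).
have := in_cone_dot_ge0 (w := - u) _ (ec N'); rewrite dotNl dotBr dotZr dot_sumr.
rewrite (eq_bigr (fun B => - delta B)); last by move=> B /inN[].
have s1 : \sum_(B in N') - delta B = - \sum_(B in N') delta B by rewrite sumrN.
rewrite s1 => /(_ _)/wrap[a|h0]; first by rewrite dotNl oppr_ge0.
have {}h0 : e * - dot u (c C) <= \sum_(B in N') delta B.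
  by rewrite mulrN; move: h0; rewrite -/C; lra.
pose q := e / #|{: L}|.+1%:R * delta C.
have q0 : 0 < q by rewrite !mulr_gt0 ?invr_gt0 ?d2.
have s2 : \sum_(B in N') delta B <= #|{: L}|%:R * q.
  apply: (@le_trans _ _ (\sum_(B in N') q)).
    by apply: ler_sum => B BN; apply: d3 => //; [case: (inN B BN)|apply: ltC].
  by rewrite sumr_const -[q *+ _]mulr_natl ler_wpM2r ?ler_nat ?max_card// ltW.
have s3 : e * delta C = #|{: L}|%:R * q + q.
  by rewrite /q -natr1; field; rewrite natr1 pnatr_eq0.
have : e * delta C <= e * - dot u (c C) by apply: ler_wpM2l; rewrite ?(ltW e0)// lerNr u_le.
by move: (#|{: L}|%:R * q) s2 s3 h0 q0 => z; lra.
Qed.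

Section FunctionalOfNested.

Definition children (N : {set L}) B : {set L} := max_elts [set C in N | (C < B)%O]%SET.

Lemma children_nested N B : nested_set F N -> B \in N ->
  children N B \subset N :\: kappa F.
Proof.
move=> [NF _ _] BN; apply/fintype.subsetP => C /max_elts_sub.
rewrite !finset.inE => /andP[CN CB]; rewrite CN andbT.
apply/negP => Ck; have := max_elts_le (F := F) _ (fintype.subsetP NF _ BN) (ltW CB).
rewrite /max_elts inE => /(_ Ck) E; by rewrite E ltxx in CB.
Qed.

Lemma children_subset_join N B (A' : {set L}) : nested_set F N -> B \in N ->
  A' \subset children N B -> (1 < #|A'|)%N -> (\join_(C in A') C)%O \notin F.
Proof.
move=> hN BN sub A1; case: (hN) => _ _; apply=> //.
  exact: fintype.subset_trans sub (children_nested hN BN).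
move=> C C' /(fintype.subsetP sub) Cc /(fintype.subsetP sub) C'c.
exact: max_elts_incomparable Cc C'c.
Qed.

Lemma children_join_lt N B : nested_set F N -> B \in N ->
  ((\join_(C in children N B) C) < B)%O.
Proof.
move=> hN BN; have BF : B \in F by case: hN => /fintype.subsetP + _ _; apply.
have ltB C : C \in children N B -> (C < B)%O.
  by move=> /max_elts_sub; rewrite finset.inE => /andP[].
rewrite lt_neqAle; apply/andP; split; last by apply/joinsP => C /ltB/ltW.
have [ch1|] := leqP #|children N B| 1; last first.
  move=> /(children_subset_join hN BN (subxx _)).
  by apply: contraNneq => ->.
have [->|[C Cc]] := finset.set_0Vmem (children N B).
  by rewrite big_set0 eq_sym -lt0x; case: bF => + _; apply.
have -> : children N B = [set C]%SET.
  by apply/esym/eqP; rewrite eqEcard finset.sub1set Cc finset.cards1.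
by rewrite big_set1 lt_eqF// ltB.
Qed.

Lemma children_factors N B : nested_set F N -> B \in N ->
  (0 < #|children N B|)%N ->
  factors F (\join_(C in children N B) C)%O = children N B.
Proof.
move=> hN BN c0; apply: (factors_join face0 face1) => //.
  move=> C /(fintype.subsetP (children_nested hN BN)).
  by rewrite finset.inE => /andP[_]; case: hN => /fintype.subsetP + _ _; apply.
by move=> A' sub; apply: (children_subset_join hN BN).
Qed.

(** A functional on the face [B] is built from those on the children of [B] in
    the nested set: the join [Y] of the children is a proper face of [B] on
    which they glue to a functional of size comparable to the largest [delta C],
    [C] a child.  Extend it to all the vectors, and subtract the multiple of the
    face functional of [Y] that gives the barycenter of [B] the value
    [- delta B].  As [delta B] is much larger than the values of the extension,
    this multiple is positive, and large enough to push down the faces of [B]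
    that are not faces of [Y]. *)
Lemma functional_of_nested : exists2 eta : R, 0 < eta &
  forall delta, hierarchy eta delta -> forall N, nested_set F N ->
  exists u, forall B, B \in F ->
    dot u (c B) <= - delta B /\ (dot u (c B) == - delta B) = (B \in N).
Proof.
have [K K1 ext] : exists2 K : R, 1 <= K & forall Y u (e : R), 0 <= e ->
    (forall a, a \in lv_set Y -> `|dot u (val a)| <= e) ->
    exists2 v, forall a, a \in lv_set Y -> dot v (val a) = dot u (val a)
            & forall a, `|dot v (val a)| <= K * e.
  pose K Y := projT1 (cid2 (bounded_extension (lv_set Y) (fun a : A => val a))).
  have [K' K'1 KK'] := fin_upper K.
  exists K' => // Y u e e0 ue.
  have := KK' Y; rewrite /K; case: cid2 => k /= k1 kext kK'.
  have [v v1 v2] := kext u e e0 ue; exists v => // a.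
  by rewrite (le_trans (v2 a))// ler_wpM2r.
have [G G1 gG] := fin_upper (fun p : L * A => dot (g p.1) (val p.2)).
have [gamma0 gamma00 gamma0P] := fin_lower (Q := fun p : L * L => ~~ (p.2 <= p.1)%O)
  (f := fun p => dot (g p.1) (c p.2)) (fun p => @face_functional_barycenter R D A p.1 p.2).
pose gamma := Num.min gamma0 1.
have gamma_gt0 : 0 < gamma by rewrite lt_min gamma00 ltr01.
have gamma_le1 : gamma <= 1 by rewrite ge_min lexx orbT.
have gammaP Y B : ~~ (B <= Y)%O -> gamma <= dot (g Y) (c B).
  by move=> h0; rewrite ge_min (gamma0P (Y, B)).
pose m0 := 1 + 2 * G / gamma.
have G0 : 0 < G by lra.
have m00 : 0 < m0 by rewrite /m0 addr_gt0// divr_gt0// mulr_gt0.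
have km0 : 0 < K * m0 + 1 by rewrite addr_gt0// mulr_gt0//; lra.
pose eta := gamma / (4 * G * (K * m0 + 1)).
have eta0 : 0 < eta by rewrite /eta divr_gt0// !mulr_gt0.
have etaE : eta * (K * m0 + 1) * (4 * G) = gamma.
  by rewrite /eta; field; apply/andP; split; apply: lt0r_neq0 => //; lra.
have m0E : m0 = 1 + 2 * G / gamma by [].
clearbody eta m0 gamma.
exists eta => // delta [d1 d2 d3] N hN; have [NF kN _] := hN.
have inF B : B \in N -> B \in F by apply: (fintype.subsetP NF).
have main B : B \in N -> exists u,
    (forall a, a \in lv_set B -> `|dot u (val a)| <= m0 * delta B) /\
    (forall C, C \in F -> (C <= B)%O ->
       dot u (c C) <= - delta C /\ (dot u (c C) == - delta C) = (C \in N)).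
  have [n] := ubnP #|lv_set B|; elim: n => // n IH in B *; rewrite ltnS => Bn BN.
  have BF := inF B BN; have dB := d2 B BF.
  pose ch := children N B; pose Y := (\join_(C in ch) C)%O.
  have YB : (Y < B)%O by apply: children_join_lt.
  have chP C : C \in ch -> (C < B)%O /\ C \in N.
    by move=> /max_elts_sub; rewrite finset.inE => /andP[].
  have al_ex C : exists u, C \in ch ->
    (forall a, a \in lv_set C -> `|dot u (val a)| <= m0 * delta C) /\
    (forall C', C' \in F -> (C' <= C)%O ->
       dot u (c C') <= - delta C' /\ (dot u (c C') == - delta C') = (C' \in N)).
    have [Cch|_] := boolP (C \in ch); last by exists 0.
    have [CB CN] := chP C Cch.
    have Cn : (#|lv_set C| < n)%N.
      apply: leq_trans Bn; apply: proper_card.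
      rewrite finset.properEneq -lv_leE (ltW CB) andbT.
      by apply/eqP => /val_inj E; move: CB; rewrite E ltxx.
    by have [u uP] := IH C Cn CN; exists u.
  pose al C := projT1 (cid (al_ex C)).
  have alP C : C \in ch -> (forall a, a \in lv_set C -> `|dot (al C) (val a)| <= m0 * delta C) /\
    (forall C', C' \in F -> (C' <= C)%O ->
       dot (al C) (c C') <= - delta C' /\ (dot (al C) (c C') == - delta C') = (C' \in N)).
    by rewrite /al; case: cid.
  have [l lE] := glue_functionals Y al.
  have facY a : a \in lv_set Y -> factors F Y = ch.
    move=> aY; apply: children_factors => //; rewrite card_gt0.
    apply/eqP => E; move: aY; rewrite /Y /ch E big_set0.
    by rewrite (lv_set_bot face0) finset.inE.
  have covY a : a \in lv_set Y -> exists2 C, C \in ch & a \in lv_set C.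
    move=> aY; rewrite -(facY a aY).
    have Y0 : (\bot < Y)%O by apply/(lt_botP face0); exists a.
    by have [+ _ _] := building_factors face0 face1 bF Y0; apply.
  have [||v vE vle] := ext Y l (m0 * (eta * delta B)).
  - by rewrite !mulr_ge0// ltW.
  - move=> a aY; have [C Cch aC] := covY a aY; have [CB CN] := chP C Cch.
    rewrite (lE C) ?(facY a aY)//; apply: le_trans ((alP C Cch).1 a aC) _.
    by rewrite ler_wpM2l ?(ltW m00)// d3// inF.
  set E := K * _ in vle.
  have E0 : 0 <= E by rewrite /E !mulr_ge0 ?(le_trans ler01 K1)// ltW.
  have vc C : `|dot v (c C)| <= E by apply: dot_barycenter_norm.
  have gB : gamma <= dot (g Y) (c B) by rewrite gammaP// lt_geF.
  have gBG : dot (g Y) (c B) <= G.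
    by apply: dot_barycenter_le => [|a _]; [exact: ltW|exact: gG (Y, a)].
  pose m := (dot v (c B) + delta B) / dot (g Y) (c B).
  have [m_gt0 EmG Em] : [/\ 0 < m, E + m * G <= m0 * delta B & E + eta * delta B < m * gamma].
    exact: (descent_estimates K1 G1 gamma_gt0 gamma_le1 m0E eta0 etaE dB
      (erefl E) (vc B) gB gBG (erefl m)).
  have mE : m * dot (g Y) (c B) = dot v (c B) + delta B.
    by rewrite /m divfK// gt_eqF// (lt_le_trans gamma_gt0).
  have gY0 C : (C <= Y)%O -> dot (g Y) (c C) = 0.
    by move=> CY; apply: dot_barycenter_eq0 => a aC; apply/face_functional0/(mem_le aC).
  exists (v - m *: g Y); split=> [a aB|C CF CB].
    rewrite dotBl dotZl; apply: (le_trans (ler_normB _ _)).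
    rewrite normrM (gtr0_norm m_gt0) (ger0_norm (face_functional_ge0 _ _)).
    apply: le_trans EmG; apply: lerD; first exact: vle.
    by rewrite ler_wpM2l ?(ltW m_gt0)// (gG (Y, a)).
  have [->|CneB] := eqVneq C B.
    rewrite dotBl dotZl mE opprD addrA subrr add0r lexx eqxx BN.
    by [].
  have ltCB : (C < B)%O by rewrite lt_neqAle CneB.
  have [CY|CY] := boolP (C <= Y)%O.
    have C0 : (\bot < C)%O by case: bF => + _; apply.
    have [a aC] := lt_botP face0 _ C0.
    have fY := facY a (mem_le aC CY).
    have [C' C'K CC'] : exists2 C', C' \in factors F Y & (C <= C')%O.
      by apply: le_max_elts; rewrite finset.inE CF.
    have -> : dot (v - m *: g Y) (c C) = dot (al C') (c C).
      rewrite dotBl dotZl gY0// mulr0 subr0 !dot_barycenter; congr (_ * _).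
      apply: eq_bigr => b bC; rewrite vE ?(mem_le bC CY)//.
      by apply: lE => //; apply: mem_le bC CC'.
    by rewrite fY in C'K; apply: (alP C' C'K).2.
  suff lt : dot (v - m *: g Y) (c C) < - delta C.
    rewrite (ltW lt) lt_eqF//; split=> //; apply/esym/negP => CN.
    have [C' C'ch CC'] : exists2 C', C' \in ch & (C <= C')%O.
      by apply: le_max_elts; rewrite finset.inE CN.
    by case/negP: CY; apply: le_trans CC' _; apply: (joins_sup (j := C')).
  rewrite dotBl dotZl ltrBlDr addrC ltrBrDr.
  have vC : dot v (c C) <= E := le_trans (ler_norm _) (vc C).
  apply: le_lt_trans (lerD vC (d3 B C BF CF ltCB)) _; apply: lt_le_trans Em _.
  by rewrite ler_wpM2l ?(ltW m_gt0)// gammaP.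
have [T0|] := boolP ((\bot : L) < \top)%O; last first.
  rewrite lt0x negbK => /eqP T0; exists 0 => B BF.
  have : (\bot < B)%O by case: bF => + _; apply.
  by rewrite lt0x -lex0 -T0 lex1.
have facT : factors F \top%O = kappa F.
  rewrite /factors /kappa; congr (max_elts _); apply/setP => B.
  by rewrite finset.inE lex1 andbT.
have al_ex B : exists u, B \in N ->
  (forall C, C \in F -> (C <= B)%O ->
     dot u (c C) <= - delta C /\ (dot u (c C) == - delta C) = (C \in N)).
  have [BN|_] := boolP (B \in N); last by exists 0.
  by have [u [_ uP]] := main B BN; exists u.
have [u uE] := glue_functionals \top%O (fun B => projT1 (cid (al_ex B))).
exists u => C CF; have [B BK CB] := le_max_elts CF.
have := uE B; rewrite facT BK => /(_ isT); case: cid => w /= wP uw.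
have -> : dot u (c C) = dot w (c C).
  rewrite !dot_barycenter; congr (_ * _); apply: eq_bigr => a aC.
  by apply: uw; apply: mem_le aC CB.
by apply: wP => //; apply: (fintype.subsetP kN).
Qed.

End FunctionalOfNested.

(** The values of [delta] are constrained only through the hierarchy, which leaves
    the freedom to choose them one by one, from the larger faces to the smaller. *)
Theorem nested_functional : exists eta : R, [/\ 0 < eta, eta < 1 &
  forall delta, hierarchy eta delta -> forall N : {set L}, nested_set F N <->
    kappa F \subset N /\ N \subset F /\
    exists u, forall B, B \in F ->
      dot u (c B) <= - delta B /\ (dot u (c B) == - delta B) = (B \in N)].
Proof.
have [e1 e10 h1'] := nested_of_functional.
have [e2 e20 h2'] := functional_of_nested.
exists (Num.min (1 / 2) (Num.min e1 e2)); split.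
- by rewrite !lt_min e10 e20 !andbT; lra.
- by rewrite gt_min; apply/orP; left; lra.
move=> delta hd N; split=> [hN|[kN [NF [u uP]]]].
  have [NF kN _] := hN; do 2!split=> //; apply: h2' hN.
  by apply: hierarchy_le hd; rewrite !ge_min lexx !orbT.
have NE : N = [set B in F | dot u (c B) == - delta B]%SET.
  apply/setP => B; rewrite finset.inE; have [BF|BF] := boolP (B \in F).
    by rewrite (uP B BF).2.
  by apply/negP => /(fintype.subsetP NF); apply/negP.
rewrite NE; apply: h1'; last by rewrite -NE.
  by apply: hierarchy_le hd; rewrite !ge_min lexx !orbT.
by move=> B /uP[].
Qed.

End Core.

(** * Convex hulls of finite sets and realization of complexes *)

Section Convexity.
Local Open Scope ring_scope.
Local Open Scope classical_set_scope.
Context {R : realType} {d : nat}.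
Implicit Types (X Y C P : set 'rV[R]_d) (x y a : 'rV[R]_d) (b : R).

Lemma finite_range (T : choiceType) (X : set T) :
  finite_set X -> exists n (x : 'I_n -> T), X = range x.
Proof.
move=> /finite_seqP[s ->]; exists (size s), (tnth (in_tuple s)).
apply/seteqP; split=> [y /= ys|_ [i _ <-]]; last exact: mem_tnth.
by have /tnthP[i ->] : y \in in_tuple s by []; exists i.
Qed.

Lemma convexP C : @convex_set R 'rV[R]_d C <->
  forall x y (t : R), C x -> C y -> 0 < t -> t < 1 -> C (t *: x + (1 - t) *: y).
Proof.
split=> [hC x y t Cx Cy t0 t1|hC].
  have := hC x y (Itv01 (ltW t0) (ltW t1)).
  by rewrite !inE => /(_ Cx Cy).
apply/convex_setW => x y; rewrite !inE => Cx Cy k k0 k1.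
by rewrite inE; apply: hC.
Qed.

Lemma conv_hull_gen X x : X x -> conv_hull X x.
Proof. by move=> Xx C [_]; apply. Qed.

Lemma conv_hull_convex X : @convex_set R 'rV[R]_d (conv_hull X).
Proof.
apply/convexP => x y t hx hy t0 t1 C [hC XC].
by move/convexP: (hC); apply=> //; [apply: hx|apply: hy].
Qed.

Lemma conv_hull_min X C : @convex_set R 'rV[R]_d C -> X `<=` C -> conv_hull X `<=` C.
Proof. exact: smallest_sub. Qed.

Lemma conv_hull_mono X Y : X `<=` Y -> conv_hull X `<=` conv_hull Y.
Proof.
move=> XY; apply: conv_hull_min; first exact: conv_hull_convex.
by move=> x /XY; apply: conv_hull_gen.
Qed.

Lemma halfspace_convex a b : @convex_set R 'rV[R]_d (halfspace a b).
Proof.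
apply/convexP => x y t; rewrite /halfspace /= => ax ay t0 t1.
have bE : b = t * b + (1 - t) * b by rewrite -mulrDl addrC subrK mul1r.
rewrite dotDr !dotZr [leRHS]bE lerD//; first by rewrite ler_wpM2l// ltW.
by rewrite ler_wpM2l// subr_ge0 ltW.
Qed.

Lemma conv_hull_halfspace X a b : X `<=` halfspace a b -> conv_hull X `<=` halfspace a b.
Proof. by apply: conv_hull_min; apply: halfspace_convex. Qed.

Lemma conv_hull_hyperplane X a b : X `<=` hyperplane a b -> conv_hull X `<=` hyperplane a b.
Proof.
move=> XH x hx; apply/eqP; rewrite eq_le.
rewrite (conv_hull_halfspace _ hx); last by move=> y /XH; rewrite /halfspace /hyperplane /= => ->.
rewrite -lerN2 -dotNl (conv_hull_halfspace _ hx)// => y /XH.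
by rewrite /halfspace /hyperplane /= dotNl => ->.
Qed.

Lemma conv_hull0 : conv_hull (set0 : set 'rV[R]_d) = set0.
Proof. by apply/seteqP; split=> // x; apply; split=> //; apply/convexP. Qed.

Lemma conv_hull1 x : conv_hull [set x] = [set x].
Proof.
apply/seteqP; split; last by move=> _ ->; apply: conv_hull_gen.
apply: conv_hull_min => //; apply/convexP => y z t /= -> -> _ _.
by rewrite -scalerDl addrC subrK scale1r.
Qed.

(** By induction on the number of points, after normalizing the partial sums of
    the weights. *)
Lemma conv_hull_comb (I : finType) X (mu : I -> R) (p : I -> 'rV[R]_d) :
  (forall i, 0 <= mu i) -> \sum_i mu i = 1 -> (forall i, X (p i)) ->
  conv_hull X (\sum_i mu i *: p i).
Proof.
move=> m0 m1 Xp.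
suff main (A : {set I}) : 0 < \sum_(i in A) mu i ->
    conv_hull X ((\sum_(i in A) mu i)^-1 *: \sum_(i in A) mu i *: p i).
  have sT (V : nmodType) (f : I -> V) : \sum_(i in [set: I]%SET) f i = \sum_i f i.
    by apply: eq_bigl => i; rewrite finset.inE.
  by have := main [set: I]%SET; rewrite !sT m1 invr1 scale1r; apply.
have [n] := ubnP #|A|; elim: n => // n IH in A *; rewrite ltnS => An s0.
have [A0|[k kA]] := finset.set_0Vmem A; first by rewrite A0 big_set0 ltxx in s0.
have Ak : (#|A :\ k|%SET < n)%N by move: An; rewrite (cardsD1 k) kA.
rewrite !(big_setD1 k kA) /= in s0 *.
have := IH _ Ak; set s := \sum_(i in _) mu i; set x := \sum_(i in _) _ => IHk.
have s_ge0 : 0 <= s by apply: sumr_ge0.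
have [s_gt0|] := ltP 0 s; last first.
  move=> s_le0; have sE : s = 0 by apply/eqP; rewrite eq_le s_le0.
  have -> : x = 0.
    apply: big1 => i iA; move/eqP: sE; rewrite psumr_eq0// => /allP/(_ i (mem_index_enum _)).
    by rewrite iA => /eqP->; rewrite scale0r.
  move: s0; rewrite -/s sE !addr0 scalerA => /lt0r_neq0 mk; rewrite mulVf// scale1r.
  exact: conv_hull_gen.
have [mk|] := ltP 0 (mu k); last first.
  move=> mk0; have -> : mu k = 0 by apply/eqP; rewrite eq_le mk0 m0.
  by rewrite scale0r !add0r; apply: IHk.
have t0 : 0 < mu k + s by rewrite addr_gt0.
move/convexP: (@conv_hull_convex X) => /(_ (p k) (s^-1 *: x) (mu k / (mu k + s))).
have -> : 1 - mu k / (mu k + s) = s / (mu k + s).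
  by apply/eqP; rewrite subr_eq -mulrDl addrC mulfV// lt0r_neq0.
rewrite scalerA mulrAC mulfV ?mul1r ?lt0r_neq0// [mu k / _]mulrC -scalerA -scalerDr.
apply; first exact: conv_hull_gen.
- exact: IHk.
- by rewrite mulr_gt0// invr_gt0.
- by rewrite mulrC ltr_pdivrMr// mul1r ltrDl.
Qed.

(** The points that lie strictly below the hyperplane, together with the convex
    hull of the generators on it, form a convex set containing all generators. *)
Lemma conv_hull_face X a b : X `<=` halfspace a b ->
  conv_hull X `&` hyperplane a b = conv_hull (X `&` hyperplane a b).
Proof.
move=> Xab; apply/seteqP; split; last first.
  move=> x hx; split; first by apply: conv_hull_mono hx => y [].
  by apply: conv_hull_hyperplane hx => y [].
pose C := [set x | dot a x < b \/ dot a x = b /\ conv_hull (X `&` hyperplane a b) x].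
suff : conv_hull X `<=` C.
  by move=> XC x [/XC[ax|[]//]]; rewrite /hyperplane /= => E; rewrite E ltxx in ax.
apply: conv_hull_min => [|x Xx]; last first.
  have := Xab x Xx; rewrite /halfspace /= le_eqVlt => /predU1P[E|]; last by left.
  by right; split=> //; apply: conv_hull_gen.
have weak x : C x -> dot a x <= b by move=> [/ltW//|[->]].
apply/convexP => x y t Cx Cy t0 t1.
have u0 : 0 < 1 - t by rewrite subr_gt0.
have bE : b = t * b + (1 - t) * b by rewrite -mulrDl addrC subrK mul1r.
case: (Cx) => [ax|[ax hx]].
  left; rewrite dotDr !dotZr [ltRHS]bE; apply: ltr_leD; first by rewrite ltr_pM2l.
  by rewrite ler_pM2l//; apply: weak.
case: (Cy) => [ay|[ay hy]].
  by left; rewrite dotDr !dotZr [ltRHS]bE ax ler_ltD// ltr_pM2l.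
right; split; first by rewrite dotDr !dotZr ax ay -bE.
by move/convexP: (@conv_hull_convex (X `&` hyperplane a b)); apply.
Qed.

Lemma conv_hullU X Y : conv_hull (conv_hull X `|` Y) = conv_hull (X `|` Y).
Proof.
apply/seteqP; split; apply: conv_hull_min; try exact: conv_hull_convex.
  move=> x [|Yx]; last by apply: conv_hull_gen; right.
  by apply: conv_hull_mono => y; left.
by move=> x [Xx|Yx]; apply: conv_hull_gen; [left; apply: conv_hull_gen|right].
Qed.

Lemma vertices_conv_hull X : vertices (conv_hull X) `<=` X.
Proof.
move=> v [a [b [sub E]]].
have Xab : X `<=` halfspace a b by move=> x Xx; apply: sub; apply: conv_hull_gen.
move: E; rewrite conv_hull_face// => E.
have [X0|/set0P[x Xx]] := eqVneq (X `&` hyperplane a b) set0.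
  by have : [set v] v by []; rewrite E X0 conv_hull0.
have : [set v] x by rewrite E; apply: conv_hull_gen.
by move=> /= <-; case: Xx.
Qed.

(** Each member of a minimal generating set of a polytope is separated from the
    convex hull of the others by Farkas' lemma; the separating functional
    attains its extremum over the polytope at that point only. *)
Lemma polytope_vertices P : polytope P ->
  finite_set (vertices P) /\ P = conv_hull (vertices P).
Proof.
move=> [X /finite_seqP[s ->]] {X}.
have [n] := ubnP (size s); elim: n => // n IH in s *; rewrite ltnS => sn PE.
have [[x xs xc]|hs] := pselect (exists2 x, x \in s & conv_hull [set y | y \in s /\ y != x] x).
  apply: (IH [seq y <- s | y != x]).
    apply: leq_trans sn; rewrite size_filter -(count_predC (pred1 x) s).
    rewrite -[X in (X < _)%N]add0n ltn_add2r -has_count.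
    by apply/hasP; exists x => /=.
  have E : [set y | y \in s /\ y != x] = [set` [seq y <- s | y != x]].
    by apply/seteqP; split=> y /=; rewrite mem_filter; [move=> [-> ->]|move=> /andP[]].
  rewrite E in xc; rewrite PE; apply/seteqP; split.
    apply: conv_hull_min; first exact: conv_hull_convex.
    move=> y /= ys; have [->//|yx] := eqVneq y x.
    by apply: conv_hull_gen; rewrite /= mem_filter yx.
  by apply: conv_hull_mono => y /=; rewrite mem_filter => /andP[].
suff VE : vertices P = [set` s] by rewrite VE; split=> //; apply: finite_set_seq.
apply/seteqP; split; first by rewrite PE; apply: vertices_conv_hull.
move=> x xs; pose s' := [seq y <- s | y != x].
pose p (i : 'I_(size s')) : 'rV[R]_(d + 1) := homogenize s'`_i.
have ps' (i : 'I_(size s')) : s'`_i \in s' by apply: mem_nth.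
have [[mu mu0 xE]|[w w0 wx]] := farkas p (homogenize x).
  case: hs; exists x => //.
  have xE' : x = \sum_i mu i *: s'`_i.
    have := congr1 lsubmx xE; rewrite row_mxKl => ->.
    rewrite (raddf_sum lsubmx); apply: eq_bigr => i _.
    by apply/rowP => j; rewrite mxE mxE row_mxEl mxE.
  rewrite [X in conv_hull _ X]xE'.
  apply: conv_hull_comb => // [|i].
    have := congr1 (fun z => rsubmx z 0 0) xE; rewrite row_mxKr [LHS]mxE => ->.
    rewrite (raddf_sum rsubmx) summxE; apply: eq_bigr => i _.
    by rewrite mxE mxE row_mxEr mxE mulr1.
  by have := ps' i; rewrite mem_filter => /andP[ix i_s]; split.
pose a := - lsubmx w.
have aE y : dot a y = - dot w (homogenize y) + dot w (homogenize x) + dot a x.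
  by rewrite !dot_homogenize !dotNl; ring.
have lt_ax y : y \in s -> y != x -> dot a y < dot a x.
  move=> ys yx; have ys' : y \in s' by rewrite mem_filter yx.
  move: ys'; rewrite -index_mem => ys'; have := w0 (Ordinal ys').
  rewrite /p /= nth_index -?index_mem// => wy.
  by have := aE y; clear -wx wy; lra.
have sub : [set` s] `<=` halfspace a (dot a x).
  by move=> y /= ys; have [->//=|yx] := eqVneq y x; [exact: lexx|exact/ltW/lt_ax].
exists a, (dot a x); split; first by rewrite PE; apply: conv_hull_halfspace.
rewrite PE conv_hull_face// -[LHS]conv_hull1; congr conv_hull.
apply/seteqP; split=> [_ ->//|y [/= ys ay]].
by apply/eqP; apply: contraTT isT => yx; have := lt_ax y ys yx; rewrite ay ltxx.
Qed.

(** The first hypothesis keeps [q0] off the proper faces, and the singletons in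
    [K] make every [q B] a vertex.  A proper face is therefore exposed by an
    inequality that is strict at [q0], and its vertices are the [q B] at which
    this inequality is tight. *)
Lemma realize_complex (T : finType) (D : {set T}) (q : T -> 'rV[R]_d) (q0 : 'rV[R]_d)
    (K : {set T} -> Prop) :
  (forall a b, (forall B, B \in D -> dot a (q B) <= b) -> dot a q0 = b ->
     forall B, B \in D -> dot a (q B) = b) ->
  (forall N : {set T}, N \subset D -> K N <-> exists a b, dot a q0 < b /\
     forall B, B \in D -> dot a (q B) <= b /\ (dot a (q B) == b) = (B \in N)) ->
  (forall B, B \in D -> K [set B]%SET) ->
  complex_iso [set [set` N] | N in [set N : {set T} | N \subset D /\ K N]]
    (boundary_complex (conv_hull ([set q0] `|` [set q B | B in [set` D]]))).
Proof.
move=> H0 H1 H2; set X := _ `|` _.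
have expose B : B \in D -> exists a b, dot a q0 < b /\
     forall C : T, C \in D -> dot a (q C) <= b /\ (dot a (q C) == b) = (C == B).
  move=> BD; have /H1[|a [b [ab abP]]] := H2 B BD; first by rewrite finset.sub1set.
  by exists a, b; split=> // C CD; rewrite -[C == B]finset.in_set1; apply: abP.
have verts (N : {set T}) a b : N \subset D -> dot a q0 < b ->
    (forall B, B \in D -> dot a (q B) <= b /\ (dot a (q B) == b) = (B \in N)) ->
    proper_face (conv_hull X) (conv_hull X `&` hyperplane a b) /\
    vertices (conv_hull X `&` hyperplane a b) = q @` [set` N].
  move=> ND ab abP.
  have Xab : X `<=` halfspace a b.
    by move=> _ [->|[B /= BD <-]]; [exact: ltW|case: (abP B BD)].
  have sub : conv_hull X `<=` halfspace a b by apply: conv_hull_halfspace.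
  split.
    split; first by exists a, b.
    move=> E; have : conv_hull X q0 by apply: conv_hull_gen; left.
    by rewrite -E => -[_]; rewrite /hyperplane /= => E'; rewrite E' ltxx in ab.
  have XE : X `&` hyperplane a b = q @` [set` N].
    apply/seteqP; split=> [x [[->|[B /= BD <-]]]|_ [B /= BN <-]].
    - by rewrite /hyperplane /= => E'; rewrite E' ltxx in ab.
    - rewrite /hyperplane /= => /eqP; have [_ ->] := abP B BD => BN.
      by exists B.
    - have BD := fintype.subsetP ND B BN.
      split; first by right; exists B.
      by apply/eqP; have [_ ->] := abP B BD.
  rewrite conv_hull_face// XE; apply/seteqP; split; first exact: vertices_conv_hull.
  move=> _ [B /= BN <-]; have BD := fintype.subsetP ND B BN.
  have [a' [b' [_ abP']]] := expose B BD.
  have NH : q @` [set` N] `<=` halfspace a' b'.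
    by move=> _ [C /= CN <-]; have [] := abP' C (fintype.subsetP ND C CN).
  exists a', b'; split; first exact: conv_hull_halfspace.
  rewrite conv_hull_face// -[LHS]conv_hull1; congr conv_hull.
  apply/seteqP; split=> [_ ->|_ [[C /= CN <-]]].
    split; first by exists B.
    by apply/eqP; have [_ ->] := abP' B BD.
  move=> /eqP; have [_ ->] := abP' C (fintype.subsetP ND C CN).
  by move=> /eqP->.
exists q; split.
  move=> B C; rewrite !inE => -[_ [N [ND _] <-] /= BN] [_ [N' [N'D _] <-] /= CN'] E.
  have [a [b [_ abP]]] := expose B (fintype.subsetP ND B BN).
  have [_ EB] := abP B (fintype.subsetP ND B BN).
  have [_ EC] := abP C (fintype.subsetP N'D C CN').
  by apply/esym/eqP; rewrite -EC -E EB.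
apply/seteqP; split=> [_ [_ [N [ND /H1[//|a [b [ab abP]]]] <-] <-]|].
  have [pf vE] := verts N a b ND ab abP.
  by exists (conv_hull X `&` hyperplane a b).
move=> _ [G [[a [b [sub GE]]] GX] <-].
have ab0 : dot a q0 <= b by apply: sub; apply: conv_hull_gen; left.
have abD B : B \in D -> dot a (q B) <= b.
  by move=> BD; apply: sub; apply: conv_hull_gen; right; exists B.
have ab : dot a q0 < b.
  rewrite lt_neqAle ab0 andbT; apply/eqP => E; apply: GX.
  rewrite GE; apply/setIidl/conv_hull_hyperplane => _ [->//|[B BD <-]].
  exact: (H0 a b).
pose N := [set B in D | dot a (q B) == b]%SET.
have ND : N \subset D by apply/fintype.subsetP => B; rewrite finset.inE => /andP[].
have abP B : B \in D -> dot a (q B) <= b /\ (dot a (q B) == b) = (B \in N).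
  by move=> BD; rewrite finset.inE BD; split=> //; apply: abD.
have [_ vE] := verts N a b ND ab abP.
exists [set` N]; first by exists N => //; split=> //; apply/H1 => //; exists a, b.
by rewrite GE vE.
Qed.

End Convexity.

(** * Stellar subdivisions and truncations of the polar *)

(** The points of a polytope that lie on no proper face of it: a valid inequality
    that is tight at such a point is tight everywhere. *)
Definition central (R : realType) (d : nat) (I : finType) (x : I -> 'rV[R]_d)
    (z : 'rV[R]_d) :=
  conv_hull (range x) z /\
  forall a b, (forall i, dot a (x i) <= b)%R -> dot a z = b -> forall i, dot a (x i) = b.

Section AffineSpan.
Local Open Scope ring_scope.
Local Open Scope classical_set_scope.
Context {R : realType} {d n : nat} (x : 'I_n -> 'rV[R]_d).
Implicit Types (a p y z : 'rV[R]_d) (b : R).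

Definition in_affine_span z :=
  forall a b, (forall i, dot a (x i) = b) -> dot a z = b.

Lemma conv_hull_affine_span z : conv_hull (range x) z -> in_affine_span z.
Proof.
move=> hz a b ab; apply: (conv_hull_hyperplane _ hz) => _ [i _ <-].
exact: ab.
Qed.

Lemma range_halfspace a b : (forall i, dot a (x i) <= b) -> range x `<=` halfspace a b.
Proof. by move=> ab _ [i _ <-]; apply: ab. Qed.

Lemma conv_hull_le z a b : conv_hull (range x) z -> (forall i, dot a (x i) <= b) -> dot a z <= b.
Proof. by move=> hz /range_halfspace ab; apply: (conv_hull_halfspace ab hz). Qed.

(** By the column space criterion applied to the homogenized points. *)
Lemma aff_hullP z : aff_hull (conv_hull (range x)) z <-> in_affine_span z.
Proof.
split=> [[m [c [p [hp c1 ->]]]] a b ab|hz].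
  rewrite dot_comb (eq_bigr (fun i => c i * b)).
    by rewrite -mulr_suml c1 mul1r.
  by move=> i _; rewrite (conv_hull_affine_span (hp i) ab).
pose U := \matrix_(i < n) homogenize (x i).
have /submxP[D] : (homogenize z <= U)%MS.
  rewrite submxE; apply/eqP/rowP => k; rewrite [RHS]mxE.
  pose w := (col k (cokermx U))^T.
  have wE (v : 'rV[R]_(d + 1)) : (v *m cokermx U) 0 k = dot w v.
    by rewrite mxE; apply: eq_bigr => i _; rewrite mulrC !mxE.
  rewrite wE dot_homogenize; apply/eqP; rewrite addr_eq0; apply/eqP/hz => i.
  apply/eqP; rewrite -addr_eq0 -dot_homogenize -wE.
  have -> : homogenize (x i) = row i U by rewrite rowK.
  by rewrite -row_mul mulmx_coker !mxE.
rewrite mulmx_sum_row => zE; exists n, (fun i => D 0 i), x; split.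
- by move=> i; apply: conv_hull_gen; exists i.
- have := congr1 (fun v => rsubmx v 0 0) zE; rewrite row_mxKr [LHS]mxE => ->.
  rewrite (raddf_sum rsubmx) summxE; apply: eq_bigr => i _.
  by rewrite rowK mxE mxE row_mxEr mxE mulr1.
- have := congr1 lsubmx zE; rewrite row_mxKl => ->.
  rewrite (raddf_sum lsubmx); apply: eq_bigr => i _.
  by apply/rowP => j; rewrite rowK mxE mxE row_mxEl mxE.
Qed.

(** Functionals on the affine span are represented by its points, since the span
    of the [x i - p] meets its orthogonal trivially. *)
Lemma affine_span_riesz p a : in_affine_span p -> exists2 y, in_affine_span y &
  forall z, in_affine_span z -> dot (z - p) (y - p) = dot (z - p) a.
Proof.
move=> hp; pose U := \matrix_(i < n) (x i - p).
pose V := kermx U^T.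
have dU (v : 'rV[R]_d) i : (v <= V)%MS -> dot v (x i - p) = 0.
  move=> /sub_kermxP E; have := congr1 (fun w : 'rV_n => w 0 i) E.
  rewrite !mxE => E'; rewrite -[RHS]E'; apply: eq_bigr => j _.
  by rewrite !mxE.
have cap0 : (U :&: V)%MS = 0.
  apply/eqP; rewrite -submx0; apply/row_subP => i.
  set v := row i _.
  have : (v <= U :&: V)%MS by apply: row_sub.
  rewrite sub_capmx => /andP[/submxP[D vE] vV].
  suff /eqP : dot v v = 0 by rewrite dot_eq0 => /eqP->; apply: sub0mx.
  rewrite {2}vE mulmx_sum_row dot_comb big1// => j _.
  by rewrite rowK dU// mulr0.
have full : row_full (U + V)%MS.
  rewrite /row_full mxrank_disjoint_sum// mxrank_ker mxrank_tr.
  by rewrite subnKC// rank_leq_col.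
have /sub_addsmxP[[D E]] : (a <= U + V)%MS by apply: submx_full.
rewrite /= => aE.
have kV : (E *m V <= V)%MS by apply: submxMl.
exists (p + D *m U).
  move=> a' b' ab'; rewrite dotDr (hp a' b' ab') mulmx_sum_row dot_comb big1 ?addr0// => i _.
  by rewrite rowK dotBr ab' (hp a' b' ab') subrr mulr0.
move=> z hz; rewrite [p + _]addrC addrK aE dotDr [dot (z - p) (E *m V)]dotC.
rewrite dotBr (hz (E *m V) (dot (E *m V) p)) ?subrr ?addr0// => i.
by apply/eqP; rewrite -subr_eq0 -dotBr dU.
Qed.

(** From a point of the relative interior one can move slightly away from any
    [x i] without leaving the polytope. *)
Lemma central_relint p :
  relint (conv_hull (range x)) p -> central x p.
Proof.
move=> [/aff_hullP sp near_p].
have [e /= e0 he] := (nbhs_ballP _ _).1 near_p.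
have Pp : conv_hull (range x) p.
  by apply: he; [exact: ballxx|exact/aff_hullP].
split=> // a b ab ap i.
pose s := 1 + \sum_j `|p 0 j - x i 0 j|.
have s0 : 0 < s by rewrite ltr_wpDr ?sumr_ge0.
pose t := e / (2 * s).
have t0 : 0 < t by rewrite divr_gt0// mulr_gt0.
have Px : conv_hull (range x) (p + t *: (p - x i)).
  apply: he; last first.
    by apply/aff_hullP => a' b' ab'; rewrite dotDr dotZr dotBr (sp _ _ ab') ab' subrr mulr0 addr0.
  split=> // i' j; rewrite /ball /= !mxE opprD addrA subrr add0r normrN normrM gtr0_norm//.
  rewrite (ord1 i').
  have : `|p 0 j - x i 0 j| <= s.
    rewrite /s (bigD1 j)//= addrCA ler_wpDr// addr_ge0// sumr_ge0//.
  move=> le_s; apply: (@le_lt_trans _ _ (t * s)); first by rewrite ler_wpM2l// ltW.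
  rewrite /t invfM mulrA -mulrA mulVf ?gt_eqF// mulr1; lra.
have := conv_hull_le Px ab.
rewrite dotDr dotZr dotBr ap gerDl pmulr_rle0// subr_le0 => bx.
by apply/eqP; rewrite eq_le ab.
Qed.

End AffineSpan.

Section StellarStep.
Local Open Scope ring_scope.
Local Open Scope classical_set_scope.
Context {R : realType} {d n : nat} (x : 'I_n -> 'rV[R]_d).
Implicit Types (a p y z : 'rV[R]_d) (b : R).
Local Notation P := (conv_hull (range x)).
Local Notation span := (in_affine_span x).

Lemma polar_ineq p y z : (dot (z - p) (y - p) <= 1) = (dot (y - p) z <= 1 + dot (y - p) p).
Proof. by rewrite dotC dotBr lerBlDr. Qed.

Lemma polar_eqn p y z : (dot (z - p) (y - p) = 1) <-> (dot (y - p) z = 1 + dot (y - p) p).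
Proof. by rewrite dotC dotBr; split=> [<-|->]; rewrite ?subrK ?addrK. Qed.

Lemma polar_convE p y :
  polar p P y <-> span y /\ forall i, dot (x i - p) (y - p) <= 1.
Proof.
rewrite /polar /=; split=> [[/aff_hullP hy h1]|[hy h1]].
  by split=> // i; apply: h1; apply: conv_hull_gen; exists i.
split=> [|z hz]; first exact/aff_hullP.
by rewrite polar_ineq (conv_hull_le hz)// => i; rewrite -polar_ineq.
Qed.

(** A vertex [y] of the polar body is determined by the generators on which it
    attains [1]: otherwise the segment from [y'] to [y] could be prolonged
    within the polar body. *)
Lemma polar_vertex p y y' : vertices (polar p P) y -> polar p P y' ->
  (forall i, dot (x i - p) (y - p) = 1 -> dot (x i - p) (y' - p) = 1) -> y' = y.
Proof.
move=> [a [b [sub E]]] hy' yy'.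
have [hy ay] : polar p P y /\ dot a y = b.
  have : [set y] y by [].
  by rewrite E => -[].
have /polar_convE[sy y1] := hy; have /polar_convE[sy' y'1] := hy'.
pose s i := dot (x i - p) (y - p); pose s' i := dot (x i - p) (y' - p).
have [t t0 tP] := fin_lower (Q := fun i => s i < 1)
   (f := fun i => (1 - s i) / (1 + `|s i - s' i|)) (fun i si =>
     divr_gt0 (eq_ind_r is_true si (subr_gt0 (s i) 1)) (ltr_wpDr (normr_ge0 _) ltr01)).
pose z := y + t *: (y - y').
have hz : polar p P z.
  apply/polar_convE; split.
    by move=> a' b' ab'; rewrite dotDr dotZr dotBr (sy _ _ ab') (sy' _ _ ab') subrr mulr0 addr0.
  move=> i; have -> : dot (x i - p) (z - p) = s i + t * (s i - s' i).
    rewrite /z addrAC dotDr dotZr; congr (_ + _ * _).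
    by rewrite /s /s' -dotBr opprB addrA subrK.
  have := y1 i; rewrite -/(s i) le_eqVlt => /predU1P[si|si].
    by have s'i : s' i = 1 := yy' i si; rewrite si s'i subrr mulr0 addr0.
  have := tP i si; rewrite ler_pdivlMr ?ltr_wpDr// mulrDr mulr1.
  have : t * (s i - s' i) <= t * `|s i - s' i| by rewrite ler_wpM2l ?ler_norm// ltW.
  by clear -t0; move: (t * _) (t * _) => u v; lra.
have az : dot a z <= b := sub _ hz; have ay' : dot a y' <= b := sub _ hy'.
suff : [set y] y' by [].
rewrite E; split=> //; apply/eqP; rewrite /hyperplane/= eq_le ay' /=.
by move: az; rewrite dotDr dotZr dotBr ay gerDl pmulr_rle0// subr_le0.
Qed.

(** The scaling makes [delta] the depth at which a valid inequality normalized at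
    [o] has to stay at [c], see [dot_lifted]. *)
Definition lifted (o c : 'rV[R]_d) (delta : R) := o + (1 - delta)^-1 *: (c - o).

Lemma dot_lifted a b o c delta : delta < 1 ->
  dot a (lifted o c delta) - b =
    (1 - delta)^-1 * ((dot a c - b) + delta * (b - dot a o)).
Proof.
move=> d1; rewrite /lifted dotDr dotZr dotBr; field.
by rewrite subr_eq0 gt_eqF.
Qed.

Lemma lifted_span o c delta : span o -> span c -> span (lifted o c delta).
Proof.
move=> so sc a b ab.
by rewrite dotDr dotZr dotBr (so a b ab) (sc a b ab) subrr mulr0 addr0.
Qed.

(** Moving the point [c] in the relative interior of a face slightly away from
    the central point [o] gives a point beyond all the facets through [c].  It
    stays beneath the finitely many others.  Polarity turns the new point into
    an inequality; the vertices of the polar body are the facets, and again only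
    finitely many of them matter, uniformly in the origin [p]. *)
Lemma stellar_step o c a0 b0 : central x o -> P c ->
  (forall i, dot a0 (x i) <= b0) -> dot a0 o < b0 -> dot a0 c = b0 ->
  (forall a b, (forall i, dot a (x i) <= b) -> dot a c = b ->
     forall i, dot a0 (x i) = b0 -> dot a (x i) = b) ->
  exists2 e : R, 0 < e < 1 & forall delta, 0 < delta -> delta < e ->
    let v := lifted o c delta in
    stellar_subdivision P (conv_hull (range x `|` [set v])) /\
    forall p, central x p ->
      face_truncation (polar p P) (polar p (conv_hull (range x `|` [set v]))).
Proof.
move=> [Po co] Pc a0b0 a0o a0c relc.
have so := conv_hull_affine_span Po; have sc := conv_hull_affine_span Pc.
(* A facet is recorded by the set [J] of generators on it.  Only one inequality
   is chosen for each [J], so that there are finitely many constraints on [delta]. *)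
pose good (J : {set 'I_n}) a b := [/\ forall i, dot a (x i) <= b,
  forall i, (dot a (x i) == b) = (i \in J) & dot a c < b].
have ex_e (J : {set 'I_n}) : exists2 e : R, 0 < e & (exists a b, good J a b) ->
    exists a b, good J a b /\
      forall delta, 0 < delta -> delta < e -> delta < 1 -> dot a (lifted o c delta) < b.
  have [[a [b [ab abJ acb]]]|no] := pselect (exists a b, good J a b); last first.
    by exists 1 => // /no.
  have ao : dot a o < b.
    rewrite lt_neqAle (conv_hull_le Po)// andbT; apply/eqP => E.
    have := conv_hull_affine_span Pc (co a b ab E) => E'.
    by rewrite E' ltxx in acb.
  exists ((b - dot a c) / (b - dot a o)); first by rewrite divr_gt0 ?subr_gt0.
  move=> _; exists a, b; split=> // delta d0; rewrite ltr_pdivlMr ?subr_gt0// => lt d1.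
  rewrite -subr_lt0 dot_lifted// pmulr_rlt0 ?invr_gt0 ?subr_gt0//.
  by clear -lt; move: (delta * _) lt => u; lra.
pose e J := s2val (cid2 (ex_e J)).
have eP J : (exists a b, good J a b) ->
    exists a b, good J a b /\
      forall delta, 0 < delta -> delta < e J -> delta < 1 -> dot a (lifted o c delta) < b.
  exact: s2valP' (cid2 (ex_e J)).
have [e1 e10 e1P] := fin_lower (Q := predT) (fun J _ => s2valP (cid2 (ex_e J)) : 0 < e J).
exists (Num.min e1 (1 / 2)).
  by rewrite lt_min e10 gt_min; apply/andP; split; [|apply/orP; right]; lra.
move=> delta d0; rewrite lt_min => /andP[de1 dh] v.
have d1 : delta < 1 by clear -dh; lra.
have l0 : 0 < (1 - delta)^-1 by rewrite invr_gt0 subr_gt0.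
have sv : span v by apply: lifted_span.
have beneathJ J : (exists a b, good J a b) -> exists a b, good J a b /\ dot a v < b.
  move=> /eP[a [b [g ab]]]; exists a, b; split=> //; apply: ab => //.
  by apply: lt_le_trans de1 (e1P J _).
have face_sub a b : (forall i, dot a (x i) <= b) -> P `<=` halfspace a b.
  by move=> ab; apply/conv_hull_halfspace/range_halfspace.
have proper_lt a b p : (forall i, dot a (x i) <= b) -> central x p ->
    (exists2 z, P z & dot a z < b) -> dot a p < b.
  move=> ab [Pp cp] [z Pz az]; rewrite lt_neqAle (conv_hull_le Pp ab) andbT.
  apply/eqP => E; have := conv_hull_affine_span Pz (cp a b ab E).
  by move=> E'; rewrite E' ltxx in az.
have v_gt a b : (forall i, dot a (x i) <= b) -> dot a c = b -> dot a o < b -> b < dot a v.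
  move=> ab ac ao; rewrite -subr_gt0 dot_lifted// ac subrr add0r.
  by rewrite !mulr_gt0// subr_gt0.
pose Phi := P `&` hyperplane a0 b0.
have PhiE : Phi = conv_hull (range x `&` hyperplane a0 b0).
  exact/conv_hull_face/range_halfspace.
have sub_face a b : (forall i, dot a (x i) <= b) -> dot a c = b -> Phi `<=` hyperplane a b.
  move=> ab ac; rewrite PhiE; apply: conv_hull_hyperplane => _ [[i _ <-]] h.
  exact: relc h.
have faceJ J a b : good J a b -> P `&` hyperplane a b = conv_hull (x @` [set` J]).
  move=> [ab abJ _]; rewrite conv_hull_face; last exact: range_halfspace.
  congr conv_hull; apply/seteqP; split=> [_ [[i _ <-] /eqP]|_ [i /= iJ <-]].
    by rewrite abJ => iJ; exists i.
  by split; [exists i|apply/eqP; rewrite abJ].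
split.
  exists Phi; split.
  - split; first by exists a0, b0; split=> //; apply: face_sub.
    move=> E; have : Phi o by rewrite E.
    by case=> _; rewrite /hyperplane /= => E'; rewrite E' ltxx in a0o.
  - by exists c.
  exists v; split.
  - exact/aff_hullP.
  - move=> G [[[a [b [sub GE]]] GP] _] PhiG; exists a, b; split=> //.
    have ab i : dot a (x i) <= b by apply: sub; apply: conv_hull_gen; exists i.
    have ac : dot a c = b.
      by have : G c; [exact: PhiG|rewrite GE => -[]].
    apply: v_gt => //; apply: proper_lt (conj Po co) _ => //.
    apply: contrapT => no; apply: GP; rewrite GE; apply: setIidl => z Pz.
    apply/eqP; rewrite /hyperplane /= eq_le (sub z Pz) leNgt /=.
    by apply/negP => az; apply: no; exists z.
  - move=> G [[[a [b [sub GE]]] GP] _] PhiG.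
    have ab i : dot a (x i) <= b by apply: sub; apply: conv_hull_gen; exists i.
    pose J := [set i | dot a (x i) == b]%SET.
    have gJ : good J a b.
      split=> // [i|]; first by rewrite finset.inE.
      rewrite lt_neqAle (conv_hull_le Pc ab) andbT; apply/eqP => ac.
      by apply: PhiG => z hz; rewrite GE; split; [case: hz|apply: (sub_face a b)].
    have [|a' [b' [g' vb']]] := beneathJ J; first by exists a, b.
    exists a', b'; split=> //; split; first by case: g' => ab' _ _; apply: face_sub.
    by rewrite GE (faceJ J a b)// (faceJ J a' b').
  - by rewrite conv_hullU.
move=> p cp; have [Pp cp'] := cp; have sp := conv_hull_affine_span Pp.
have polar0 : polar p P p.
  by apply/polar_convE; split=> // i; rewrite subrr dot0r ler01.
(* a valid inequality, scaled to have slack [1] at [p], is a point of the polar *)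
have repr a b : (forall i, dot a (x i) <= b) -> dot a p < b ->
    exists2 y, polar p P y &
      forall z, span z -> dot (z - p) (y - p) = (dot a z - dot a p) / (b - dot a p).
  move=> ab ap; have bp : 0 < b - dot a p by rewrite subr_gt0.
  have [y sy yE] := affine_span_riesz ((b - dot a p)^-1 *: a) sp.
  have yE' z : span z -> dot (z - p) (y - p) = (dot a z - dot a p) / (b - dot a p).
    by move=> sz; rewrite yE// dotZr [dot (z - p) a]dotC dotBr mulrC.
  exists y => //; apply/polar_convE; split=> // i.
  rewrite yE'; first by rewrite ler_pdivrMr// mul1r lerB.
  by apply: conv_hull_affine_span; apply: conv_hull_gen; exists i.
have a0p : dot a0 p < b0 by apply: proper_lt cp _ => //; exists o.
pose Gp := polar p P `&` hyperplane (c - p) (1 + dot (c - p) p).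
have GpP y : Gp y <-> polar p P y /\ dot (c - p) (y - p) = 1.
  by rewrite dotC; split=> -[hy /polar_eqn] E; split=> //; rewrite dotC.
have polar_sub z : (P z) -> polar p P `<=` halfspace (z - p) (1 + dot (z - p) p).
  move=> Pz y [_ /(_ z Pz)]; rewrite /halfspace /= dotBr; lra.
exists Gp; split.
- split; first by exists (c - p), (1 + dot (c - p) p); split=> //; apply: polar_sub.
  move=> E; have /GpP[_] : Gp p by rewrite E.
  by rewrite subrr dot0r => /eqP; rewrite eq_sym oner_eq0.
- have [y hy yE] := repr a0 b0 a0b0 a0p.
  by exists y; apply/GpP; split=> //; rewrite yE// a0c divff// subr_eq0 gt_eqF.
exists (v - p), (1 + dot (v - p) p).
have hsP y : halfspace (v - p) (1 + dot (v - p) p) y <-> dot (v - p) (y - p) <= 1.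
  by rewrite /halfspace /= dotBr lerBlDr.
split.
- apply/seteqP; split=> // y [/GpP[hy yc] /hsP]; apply/negP; rewrite -ltNge.
  have /polar_convE[_ y1] := hy.
  have : 1 + dot (y - p) p < dot (y - p) v.
    apply: v_gt => [i||]; first by rewrite -polar_ineq.
      exact/polar_eqn.
    apply: proper_lt (conj Po co) _ => [i|]; first by rewrite -polar_ineq.
    by exists p => //; rewrite ltrDr ltr01.
  by rewrite [dot (v - p) _]dotC dotBr; lra.
- move=> y yv nGy; have hy : polar p P y.
    case: yv => [a [b [_ E]]]; have : [set y] y by [].
    by rewrite E => -[].
  have /polar_convE[_ y1] := hy.
  have y1' i : dot (y - p) (x i) <= 1 + dot (y - p) p by rewrite -polar_ineq.
  pose J := [set i | dot (y - p) (x i) == 1 + dot (y - p) p]%SET.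
  have gJ : good J (y - p) (1 + dot (y - p) p).
    split=> // [i|]; first by rewrite finset.inE.
    rewrite lt_neqAle (conv_hull_le Pc y1') andbT; apply/eqP => /polar_eqn E.
    by apply: nGy; apply/GpP.
  have [|a' [b' [[ab' abJ' ac'] vb']]] := beneathJ J; first by exists (y - p), (1 + dot (y - p) p).
  have ap' : dot a' p < b' by apply: proper_lt cp _ => //; exists c.
  have [y' hy' yE'] := repr a' b' ab' ap'.
  have yy : y' = y.
    apply: polar_vertex yv hy' _ => i /polar_eqn/eqP; have [_ -> _] := gJ.
    rewrite -abJ' => /eqP E; rewrite yE'; last first.
      by apply: conv_hull_affine_span; apply: conv_hull_gen; exists i.
    by rewrite E divff// subr_eq0 gt_eqF.
  have : dot (v - p) (y - p) < 1.
    by rewrite -yy yE'// ltr_pdivrMr ?subr_gt0// mul1r ltrD2r.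
  by rewrite dotBr; lra.
- apply/seteqP; split=> [y|y [hy /hsP yv]].
    move=> [ay y1]; split; last first.
      by apply/hsP; apply: y1; apply: conv_hull_gen; right.
    have sub : P `<=` conv_hull (range x `|` [set v]).
      by apply: conv_hull_mono => z; left.
    split=> [|z /sub/y1//]; apply/aff_hullP => a b ab.
    case: ay => m [k [q [hq k1 ->]]]; rewrite dot_comb (eq_bigr (fun i => k i * b)).
      by rewrite -mulr_suml k1 mul1r.
    move=> i _; congr (_ * _); apply: (conv_hull_hyperplane _ (hq i)) => z.
    by move=> [[j _ <-]|->]; [exact: ab|exact: sv].
  have /polar_convE[sy y1] := hy.
  split.
    have [m [k [q [hq k1 ->]]]] : aff_hull P y by apply/aff_hullP.
    exists m, k, q; split=> // i.
    by apply: conv_hull_mono (hq i) => z; left.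
  move=> z hz; rewrite polar_ineq; apply: (conv_hull_halfspace _ hz) => w.
  rewrite /halfspace /= -polar_ineq => -[[i _ <-]|->//].
  exact: y1.
Qed.

End StellarStep.

(** * The vertex configuration of a polytope *)

Section PolytopeMatroid.
Local Open Scope ring_scope.
Local Open Scope classical_set_scope.
Context {R : realType} {d : nat} (P : set 'rV[R]_d) (hP : polytope P).
Local Notation A := (homogenized_vertices P).
Local Notation L := (lvFace (polytope_matroid P)).
Implicit Types (a : A) (B C K : L).

Lemma homogenized_verticesP u : u \in A <-> exists2 v, vertices P v & homogenize v = u.
Proof.
have fin : finite_set [set homogenize v | v in vertices P].
  by apply: finite_image; case: (polytope_vertices hP).
rewrite /homogenized_vertices in_fset_set//; split; first by move=> /set_mem.
by move=> h; apply/mem_set.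
Qed.

Definition vertex_of a : 'rV[R]_d := lsubmx (val a).

Lemma vertex_ofP a : vertices P (vertex_of a) /\ homogenize (vertex_of a) = val a.
Proof.
have [v vP vE] := (homogenized_verticesP (val a)).1 (valP a).
by rewrite /vertex_of -vE row_mxKl.
Qed.

Lemma homogenize_vertex_of a : homogenize (vertex_of a) = val a.
Proof. by case: (vertex_ofP a). Qed.

Lemma vertex_of_surj v : vertices P v -> exists a, vertex_of a = v.
Proof.
move=> vP; have vA : homogenize v \in A by apply/homogenized_verticesP; exists v.
by exists [` vA]%fset; rewrite /vertex_of /= row_mxKl.
Qed.

Lemma verticesE : vertices P = range vertex_of.
Proof.
apply/seteqP; split=> [v /vertex_of_surj[a <-]|_ [a _ <-]]; first by exists a.
by case: (vertex_ofP a).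
Qed.

Lemma polytopeE : P = conv_hull (range vertex_of).
Proof. by rewrite -verticesE; case: (polytope_vertices hP). Qed.

Definition height : 'rV[R]_(d + 1) := row_mx 0 (const_mx 1).

Lemma height1 a : dot height (val a) = 1.
Proof. by rewrite -homogenize_vertex_of dot_row_homogenize dot0l add0r. Qed.

(** The functional on the homogenized space that represents the inequality
    [dot a x <= b]. *)
Definition slack (a : 'rV[R]_d) (b : R) : 'rV[R]_(d + 1) := row_mx (- a) (const_mx b).

Lemma slackE (n : 'rV[R]_d) b x : dot (slack n b) (homogenize x) = b - dot n x.
Proof. by rewrite dot_row_homogenize dotNl addrC. Qed.

Lemma lv_face_vertex a : lv_face (polytope_matroid P) [set a]%SET.
Proof.
have [[n [b [sub E]]] _] := vertex_ofP a.
apply/config_faceP; exists (slack n b); split=> c.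
  rewrite finset.inE => /eqP->; rewrite -homogenize_vertex_of slackE.
  have : [set vertex_of a] (vertex_of a) by [].
  by rewrite E => -[_]; rewrite /hyperplane /= => ->; rewrite subrr.
rewrite finset.inE -homogenize_vertex_of slackE subr_gt0 => ca.
have Pc : P (vertex_of c) by rewrite polytopeE; apply: conv_hull_gen; exists c.
rewrite lt_neqAle (sub _ Pc) andbT; apply: contra ca => /eqP nc.
have : [set vertex_of a] (vertex_of c) by rewrite E.
by move=> /= cE; apply/eqP/val_inj; rewrite -!homogenize_vertex_of cE.
Qed.

Let face0 := lv_face0 height1.
Local Notation pt a := (LVFace (lv_face_vertex a)).

Definition face_center B : 'rV[R]_d := lsubmx (barycenter B).

Lemma homogenize_face_center B : (\bot < B)%O -> homogenize (face_center B) = barycenter B.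
Proof.
move=> B0; rewrite -[RHS]hsubmxK; congr row_mx.
apply/rowP => i; rewrite (ord1 i) mxE.
have := height_barycenter height1 B0; rewrite -[X in dot _ X]hsubmxK => <-.
rewrite /height /dot big_split_ord /= big1 ?add0r => [|j _]; last by rewrite row_mxEl mxE mul0r.
by rewrite big_ord1 !row_mxEr mxE mul1r.
Qed.

Lemma slack_face_center B n b : (\bot < B)%O ->
  b - dot n (face_center B) = dot (slack n b) (barycenter B).
Proof. by move=> B0; rewrite -homogenize_face_center// slackE. Qed.

Lemma face_center_pt a : face_center (pt a) = vertex_of a.
Proof. by rewrite /face_center barycenter_pt. Qed.

Lemma face_center_in B : (\bot < B)%O -> conv_hull (range vertex_of) (face_center B).
Proof.
move=> B0; have B0' := B0; rewrite (gt_bot height1) in B0'.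
pose mu a : R := if a \in lv_set B then #|lv_set B|%:R^-1 else 0.
have -> : face_center B = \sum_a mu a *: vertex_of a.
  apply/rowP => j; rewrite /face_center /barycenter scaler_sumr big_mkcond /=.
  rewrite [LHS]mxE !summxE; apply: eq_bigr => a _; rewrite /mu.
  by case: ifP => _; rewrite !mxE ?mul0r.
apply: conv_hull_comb => [a||a]; last by exists a.
  by rewrite /mu; case: ifP => // _; rewrite invr_ge0.
by rewrite -big_mkcond sumr_const /= -[_^-1 *+ _]mulr_natr mulVf// pnatr_eq0 -lt0n.
Qed.

Lemma face_center_extremal B n b : (\bot < B)%O ->
  (forall a, a \in lv_set B -> dot n (vertex_of a) <= b) -> dot n (face_center B) = b ->
  forall a, a \in lv_set B -> dot n (vertex_of a) = b.
Proof.
move=> B0 nb nB a aB.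
have E : dot (slack n b) (barycenter B) = 0 by rewrite -slack_face_center// nB subrr.
apply/eqP; rewrite eq_le nb//= leNgt; apply/negP => lt.
suff : 0 < dot (slack n b) (barycenter B) by rewrite E ltxx.
apply: (dot_barycenter_gt0 (a := a)) => // [c cB|].
  by rewrite -homogenize_vertex_of slackE subr_ge0 nb.
by rewrite -homogenize_vertex_of slackE subr_gt0.
Qed.

Section Realization.
Context (F : {set L}) (bF : building_set F).

Let F0 B : B \in F -> (\bot < B)%O. Proof. by case: bF => + _; apply. Qed.

Lemma kappa_sub K : K \in kappa F -> K \in F.
Proof. exact: max_elts_sub. Qed.

(** The form of [nested_functional] in which only the members of [F] outside
    [kappa F] are indices of points. *)
Lemma nested_weights : exists eta : R, [/\ 0 < eta, eta < 1 & forall delta,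
  hierarchy F eta delta -> forall N : {set L}, N \subset (F :\: kappa F)%SET ->
  nested_set F (N :|: kappa F)%SET <-> exists u : 'rV[R]_(d + 1),
    (forall K, K \in kappa F -> dot u (barycenter K) = -1) /\
    forall B, B \in (F :\: kappa F)%SET -> dot u (barycenter B) <= - delta B /\
       (dot u (barycenter B) == - delta B) = (B \in N)].
Proof.
have [eta [e0 e1 H]] := nested_functional height1 lv_face_vertex bF.
exists eta; split=> // delta hd N ND; have [dk _ _] := hd; rewrite (H delta hd).
split=> [[_ [_ [u uP]]]|[u [uk uD]]].
  exists u; split=> [K KK|B].
    have [_] := uP K (kappa_sub KK).
    by rewrite dk// finset.in_setU KK orbT => /eqP.
  rewrite finset.in_setD => /andP[Bk BF].
  by have := uP B BF; rewrite finset.in_setU (negbTE Bk) orbF.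
split; first exact: finset.subsetUr.
split.
  rewrite finset.subUset; apply/andP; split; last by apply/fintype.subsetP => K /kappa_sub.
  by apply: (fintype.subset_trans ND); apply: finset.subsetDl.
exists u => B BF; rewrite finset.in_setU; have [Bk|Bk] := boolP (B \in kappa F).
  by rewrite uk// dk// lexx eqxx orbT.
by rewrite orbF; apply: uD; rewrite finset.in_setD Bk.
Qed.

Lemma sign_scale (X b k t e : R) : 0 < k -> X - b = k * (t + e) ->
  (X <= b) = (t <= - e) /\ (X == b) = (t == - e).
Proof.
move=> k0 E; rewrite -subr_le0 -subr_eq0 E pmulr_rle0// mulf_eq0 (gt_eqF k0) /=.
by rewrite -[e]opprK subr_le0 subr_eq0 opprK.
Qed.

Lemma vertex_in_kappa a : exists2 K, K \in kappa F & a \in lv_set K.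
Proof.
have [K KK aK] := le_max_elts (building_pt face0 lv_face_vertex a bF).
by exists K => //; rewrite -(pt_le lv_face_vertex).
Qed.

(** The vertices belong to [F] and are covered by the members of [kappa F], at
    whose barycenters [w] attains its maximum [0]. *)
Lemma kappa_tight (w : 'rV[R]_(d + 1)) :
  (forall K, K \in kappa F -> dot w (barycenter K) = 0) ->
  (forall B, B \in (F :\: kappa F)%SET -> dot w (barycenter B) <= 0) ->
  forall B, dot w (barycenter B) = 0.
Proof.
move=> wk wD.
have wle a : dot w (val a) <= 0.
  rewrite -(barycenter_pt lv_face_vertex); have [k|k] := boolP (pt a \in kappa F).
    by rewrite wk.
  by apply: wD; rewrite finset.in_setD k (building_pt face0).
have w0 a : dot w (val a) = 0.
  have [K KK aK] := vertex_in_kappa a.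
  apply/eqP; rewrite eq_le wle leNgt; apply/negP => lt.
  suff : 0 < dot (- w) (barycenter K) by rewrite dotNl wk// oppr0 ltxx.
  apply: (dot_barycenter_gt0 (a := a)) => // [c _|]; first by rewrite dotNl oppr_ge0.
  by rewrite dotNl oppr_gt0.
by move=> B; apply: dot_barycenter_eq0 => a _.
Qed.

Lemma hierarchy_exists (eta : R) : 0 < eta -> eta < 1 -> exists delta, hierarchy F eta delta.
Proof.
move=> e0 e1; exists (fun B => if B \in kappa F then 1 else eta ^+ (#|{: A}|.+1 - #|lv_set B|)).
have cA B : (#|lv_set B| <= #|{: A}|)%N by apply: max_card.
split=> [K -> //|B BF|B C BF CF CB].
  by case: ifP => // _; rewrite exprn_gt0.
have Ck : C \notin kappa F.
  by apply/negP => /max_elts_le /(_ BF (ltW CB)) E; rewrite E ltxx in CB.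
have cCB : (#|lv_set C| < #|lv_set B|)%N.
  apply: proper_card; rewrite finset.properEneq -lv_leE (ltW CB) andbT.
  by apply/eqP => /val_inj E; rewrite E ltxx in CB.
rewrite (negbTE Ck); have [_|_] := boolP (B \in kappa F).
  have cC := leq_trans cCB (cA B).
  rewrite mulr1 subSn ?(ltnW cC)// exprS ger_pMr//.
  by rewrite exprn_ile1 ?ltW.
rewrite -exprS; apply: ler_wiXn2l; rewrite ?ltW//.
by rewrite ltn_sub2l// ltnS cA.
Qed.

(** The realizing polytope lives in the quotient by the barycenters of the
    members of [kappa F].  A functional with value [-1] at these barycenters is a
    functional on the quotient minus [height]. *)
Lemma realize_quotient : exists (e : nat) (Q : set 'rV[R]_e),
  polytope Q /\ complex_iso (facial_nested_complex F) (boundary_complex Q).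
Proof.
have [eta [e0 e1 H]] := nested_weights.
have [delta hd] := hierarchy_exists e0 e1; have [dk dpos dlt] := hd.
pose D := (F :\: kappa F)%SET.
pose k (i : 'I_#|{: L}|) := if enum_val i \in kappa F then barycenter (enum_val i) else 0.
have [M [Mk Mq]] := quotient_functional k.
have Mkappa K : K \in kappa F -> barycenter K *m M = 0.
  by move=> KK; have := Mk (enum_rank K); rewrite /k enum_rankK KK.
have {}Mq w : (forall K, K \in kappa F -> dot w (barycenter K) = 0) ->
    exists n, forall u, dot n (u *m M) = dot w u.
  by move=> wk; apply: Mq => i; rewrite /k; case: ifP => [/wk//|_]; rewrite dot0r.
have d1 B : B \in D -> 0 < (1 - delta B)^-1.
  rewrite finset.in_setD => /andP[Bk BF]; have [K KK BK] := le_max_elts BF.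
  rewrite invr_gt0 subr_gt0; apply: le_lt_trans e1.
  rewrite -[eta]mulr1 -(dk K KK); apply: (dlt K B (kappa_sub KK) BF).
  by rewrite lt_neqAle BK andbT; apply: contraNneq Bk => ->.
pose q B := (1 - delta B)^-1 *: (barycenter B *m M).
have hB B : B \in D -> dot height (barycenter B) = 1.
  by rewrite finset.in_setD => /andP[_ /F0]; apply: (height_barycenter height1).
exists (d + 1)%N, (conv_hull ([set 0] `|` [set q B | B in [set` D]])); split.
  eexists; last reflexivity.
  by rewrite finite_setU; split; [exact: finite_set1|exact/finite_image/finite_finset].
rewrite /facial_nested_complex nested_complexE.
apply: (@realize_complex R (d + 1)%N L D q 0 (fun N => nested_set F (N :|: kappa F)%SET)).
- move=> a b aq; rewrite dot0r => b0 B BD; rewrite -b0.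
  pose w := a *m M^T.
  have wE C : C \in D -> dot a (q C) = (1 - delta C)^-1 * dot w (barycenter C).
    by move=> CD; rewrite dotZr dot_mulmx.
  rewrite wE// (kappa_tight (w := w)) ?mulr0// => [K KK|C CD].
    by rewrite dot_mulmx Mkappa// dot0r.
  by have := aq C CD; rewrite wE// -b0 pmulr_rle0// d1.
- move=> N ND; rewrite (H delta hd)//; split=> [[u [uk uD]]|[a [b [ab abP]]]].
    have [|a aE] := Mq (u + height).
      by move=> K KK; rewrite dotDl uk// (height_barycenter height1 (F0 (kappa_sub KK))) addNr.
    exists a, 1; split=> [|B BD]; first by rewrite dot0r ltr01.
    have E : dot a (q B) - 1 = (1 - delta B)^-1 * (dot u (barycenter B) + delta B).
      rewrite dotZr aE dotDl hB//; field.
      by rewrite -invr_eq0 gt_eqF// d1.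
    by have [-> ->] := sign_scale (d1 B BD) E; apply: uD.
  rewrite dot0r in ab.
  exists (b^-1 *: (a *m M^T) - height); split=> [K KK|B BD].
    rewrite dotBl dotZl dot_mulmx Mkappa// dot0r mulr0 sub0r.
    by rewrite (height_barycenter height1 (F0 (kappa_sub KK))).
  have E : dot a (q B) - b = b * (1 - delta B)^-1 *
      (dot (b^-1 *: (a *m M^T) - height) (barycenter B) + delta B).
    rewrite dotZr dotBl dotZl dot_mulmx hB//; field.
    by rewrite gt_eqF// -invr_eq0 gt_eqF// d1.
  by have [<- <-] := sign_scale (mulr_gt0 ab (d1 B BD)) E; apply: abP.
- by move=> B BD; apply: nested_single.
Qed.

End Realization.
End PolytopeMatroid.

(** * Connected building sets *)

Section Connected.
Local Open Scope ring_scope.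
Local Open Scope classical_set_scope.
Context {R : realType} {d : nat} (P : set 'rV[R]_d) (hP : polytope P).
Local Notation A := (homogenized_vertices P).
Local Notation L := (lvFace (polytope_matroid P)).
Local Notation g := face_functional.
Implicit Types (B C K : L) (n z : 'rV[R]_d) (b : R) (s : seq L) (delta : L -> R).
Context (F : {set L}) (bF : building_set F) (cF : building_connected F).
Local Notation o := (face_center (\top%O : L)).
Local Notation vertex_of := (@vertex_of R d P).

Let F0 B : B \in F -> (\bot < B)%O. Proof. by case: bF => + _; apply. Qed.

Lemma kappa_top : kappa F = [set \top%O]%SET.
Proof.
have /eqP/cards1P[K KE] := cF; rewrite KE; congr [set _]%SET.
apply: le_anti; rewrite lex1 lv_leE; apply/fintype.subsetP => a _.
by have [K'] := vertex_in_kappa hP bF a; rewrite KE finset.inE => /eqP->.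
Qed.

Lemma top_gt_bot : (\bot < (\top : L))%O.
Proof. by apply/F0/max_elts_sub; rewrite -/(kappa F) kappa_top finset.inE. Qed.

Definition lifted_center delta B := lifted o (face_center B) (delta B).

Definition generators delta s : set 'rV[R]_d :=
  range vertex_of `|` [set lifted_center delta B | B in [set` s]].

Lemma finite_generators delta s : finite_set (generators delta s).
Proof.
rewrite finite_setU; split; last exact/finite_image/finite_seq.
exact: finite_image.
Qed.

Lemma face_center_tight n b B : (\bot < B)%O ->
  (forall a, dot n (vertex_of a) = b) -> dot n (face_center B) = b.
Proof.
move=> B0 nb; apply: (conv_hull_hyperplane _ (face_center_in hP B0)).
by move=> _ [a _ <-]; apply: nb.
Qed.

Local Notation inner := (central vertex_of).

Lemma inner_top : inner o.
Proof.
split; first exact: (face_center_in hP top_gt_bot).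
move=> n b nb no a; apply: (face_center_extremal hP top_gt_bot _ no).
  by move=> a' _; apply: nb.
by have := finset.in_setT a.
Qed.

Lemma relint_inner z : relint P z -> inner z.
Proof.
have [m [x xE]] : exists m (x : 'I_m -> 'rV[R]_d), range vertex_of = range x.
  exact/finite_range/finite_image.
move=> hz; have /central_relint[{}hz cz] : relint (conv_hull (range x)) z.
  by rewrite -xE -(polytopeE hP).
split; first exact: (eq_ind_r (fun X => conv_hull X z) hz xE).
move=> n b nb nz a; have [i _ <-] : range x (vertex_of a) by rewrite -xE; exists a.
apply: (cz n b _ nz) => j.
by have [a' _ <-] : range vertex_of (x j) by rewrite xE; exists j.
Qed.

Lemma inner_central delta s m (x : 'I_m -> 'rV[R]_d) z : {subset s <= F} ->
  generators delta s = range x -> inner z -> central x z.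
Proof.
move=> sF xE [hz cz]; split.
  by rewrite -xE; apply: conv_hull_mono hz => y; left.
move=> n b nx nz.
have np a : dot n (vertex_of a) = b.
  apply: cz (nz) a => a; have [i _ <-] : range x (vertex_of a); last exact: nx.
  by rewrite -xE; left; exists a.
move=> i; have : generators delta s (x i) by rewrite xE; exists i.
case=> [[a _ <-]//|[B /= Bs <-]].
rewrite /lifted_center /lifted dotDr dotZr dotBr (face_center_tight top_gt_bot np).
by rewrite (face_center_tight (F0 (sF B Bs)) np) subrr mulr0 addr0.
Qed.

(** Lifting the faces one by one, larger faces first, each depth being small
    compared to the preceding ones.  The bound on [eta] ensures that the lifted
    points stay off the hyperplanes exposing the faces still to be subdivided. *)
Lemma subdivision_chain (eta : R) : 0 < eta -> eta < 1 ->
  (forall B C, ~~ (C <= B)%O ->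
     eta * dot (g B) (barycenter (\top%O : L)) < dot (g B) (barycenter C)) ->
  forall s, {subset s <= F :\: kappa F}%SET -> pairwise (fun C B => ~~ (C <= B)%O) s ->
  exists delta, [/\ forall B, B \in s -> 0 < delta B <= eta,
    forall B C, B \in s -> C \in s -> (C < B)%O -> delta C <= eta * delta B,
    clos_refl_trans _ stellar_subdivision P (conv_hull (generators delta s))
  & forall p, relint P p -> clos_refl_trans _ face_truncation (polar p P)
      (polar p (conv_hull (generators delta s)))].
Proof.
move=> e0 e1 small; elim/last_ind => [_ _|s B IH sD].
  have PE : conv_hull (generators (fun=> 0) [::]) = P.
    rewrite [RHS](polytopeE hP); congr conv_hull.
    by apply/seteqP; split=> [y [//|[]]|y]; [|left].
  exists (fun=> 0); split=> //; first by rewrite PE; apply: rt_refl.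
  by move=> p _; rewrite PE; apply: rt_refl.
rewrite pairwise_rcons => /andP[/allP /= sB ps].
have sub C : C \in s -> C \in (F :\: kappa F)%SET.
  by move=> Cs; apply: sD; rewrite mem_rcons inE Cs orbT.
have /IH {IH} := sub => /(_ ps) [delta [dpos dlt chain pchain]].
have sF C : C \in s -> C \in F by move=> /sub; rewrite finset.inE => /andP[].
have /andP[Bk BF] : (B \notin kappa F) && (B \in F).
  by rewrite -finset.in_setD; apply: sD; rewrite mem_rcons inE eqxx.
have B0 := F0 BF.
have Bs : B \notin s by apply/negP => /sB; rewrite lexx.
have [m [x xE]] := finite_range (finite_generators delta s).
pose n := - lsubmx (g B); pose b := rsubmx (g B) 0 0.
have nE y : b - dot n y = dot (g B) (homogenize y).
  by rewrite dot_homogenize /n dotNl opprK addrC.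
have nC C : (\bot < C)%O -> b - dot n (face_center C) = dot (g B) (barycenter C).
  by move=> C0; rewrite nE (homogenize_face_center hP).
have n_lift C : C \in s -> dot n (lifted_center delta C) < b.
  move=> Cs; have /andP[dC dCe] := dpos C Cs.
  have dC1 : delta C < 1 := le_lt_trans dCe e1.
  rewrite -subr_lt0 dot_lifted// pmulr_rlt0 ?invr_gt0 ?subr_gt0//.
  rewrite -opprB (nC C (F0 (sF C Cs))) (nC _ top_gt_bot) addrC subr_lt0.
  apply: le_lt_trans (small B C (sB C Cs)); apply: ler_wpM2r => //.
  by apply: dot_barycenter_ge0 => a _; apply: face_functional_ge0.
have n_point a : dot n (vertex_of a) <= b.
  by rewrite -subr_ge0 nE (homogenize_vertex_of hP) face_functional_ge0.
have [||||||e /andP[eps0 eps1] step] := @stellar_step R d m x o (face_center B) n b.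
- exact: inner_central xE inner_top.
- rewrite -xE; apply: conv_hull_mono (face_center_in hP B0) => y; by left.
- move=> i; have : generators delta s (x i) by rewrite xE; exists i.
  by case=> [[a _ <-]//|[C /= Cs <-]]; apply/ltW/n_lift.
- rewrite -subr_gt0 (nC _ top_gt_bot) face_functional_barycenter//.
  by apply: contra Bk => TB; rewrite kappa_top finset.inE; apply/eqP/le_anti; rewrite lex1.
- apply/eqP; rewrite eq_sym -subr_eq0 nC//; apply/eqP/dot_barycenter_eq0 => a.
  exact: face_functional0.
- move=> n' b' n'x n'B i.
  have n'p a : dot n' (vertex_of a) <= b'.
    by have [j _ <-] : range x (vertex_of a); [rewrite -xE; left; exists a|].
  have : generators delta s (x i) by rewrite xE; exists i.
  case=> [[a _ <-]|[C /= Cs <-] nCb]; last by have := n_lift C Cs; rewrite nCb ltxx.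
  move=> /eqP; rewrite eq_sym -subr_eq0 nE (homogenize_vertex_of hP) => ga.
  apply: (face_center_extremal hP B0 _ n'B) => [a' _|]; first exact: n'p.
  by apply: contraLR ga => /face_functional_gt0 /lt0r_neq0.
have [mu mu0 muP] := fin_lower (Q := fun C => C \in s) (f := delta)
  (fun C Cs => (andP (dpos C Cs)).1).
pose r := Num.min e (Num.min eta (eta * mu)) / 2.
have mm0 : 0 < Num.min e (Num.min eta (eta * mu)) by rewrite !lt_min eps0 e0 mulr_gt0.
have r0 : 0 < r by rewrite divr_gt0.
have : r < Num.min e (Num.min eta (eta * mu)) by rewrite /r ltr_pdivrMr//; lra.
rewrite !lt_min => /and3P[re reta rmu].
pose delta' C := if C == B then r else delta C.
have d's C : C \in s -> delta' C = delta C.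
  by move=> Cs; rewrite /delta'; case: eqP => // E; rewrite -E Cs in Bs.
have d'B : delta' B = r by rewrite /delta' eqxx.
have genE : generators delta' (rcons s B) = range x `|` [set lifted o (face_center B) r].
  rewrite -xE /generators -setUA; congr (_ `|` _); apply/seteqP; split.
    move=> y [C /=]; rewrite mem_rcons inE => /predU1P[->|Cs] <-.
      by right; rewrite /lifted_center d'B.
    by left; exists C => //; rewrite /lifted_center d's.
  move=> _ [[C /= Cs <-]|->].
    by exists C; rewrite /= ?mem_rcons ?inE ?Cs ?orbT// /lifted_center d's.
  by exists B; rewrite /= ?mem_rcons ?inE ?eqxx// /lifted_center d'B.
have [st pst] := step r r0 re.
exists delta'; split=> [C|C C'||p hp].
- rewrite mem_rcons inE => /predU1P[->|Cs]; first by rewrite d'B r0 ltW.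
  by rewrite d's// dpos.
- rewrite !mem_rcons !inE => /predU1P[->|Cs] /predU1P[->|C's].
  + by rewrite ltxx.
  + by move=> /ltW le; have := sB C' C's; rewrite le.
  + move=> _; rewrite d'B d's//; apply: (le_trans (ltW rmu)).
    by rewrite ler_wpM2l ?(ltW e0)// muP.
  + by rewrite !d's//; apply: dlt.
- apply: rt_trans chain _; apply: rt_step.
  by rewrite genE xE.
- apply: rt_trans (pchain p hp) _; apply: rt_step.
  rewrite genE xE; apply: pst; exact: inner_central xE (relint_inner hp).
Qed.

(** The vertices of [P] lie between [o] and the lifted vertices. *)
Lemma conv_hull_lifted_centers delta : (forall B, B \in (F :\: kappa F)%SET -> 0 < delta B < 1) ->
  conv_hull (generators delta (enum (F :\: kappa F)%SET)) =
  conv_hull ([set o] `|` [set lifted_center delta B | B in [set` (F :\: kappa F)%SET]]).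
Proof.
move=> d01; set D := (F :\: kappa F)%SET; set X := _ `|` _.
apply/seteqP; split; apply: conv_hull_min; try exact: conv_hull_convex.
  move=> y [[a _ <-]|[B /=]]; last first.
    by rewrite mem_enum => BD <-; apply: conv_hull_gen; right; exists B.
  have Xo : conv_hull X o by apply: conv_hull_gen; left.
  rewrite -(face_center_pt hP); set B := LVFace _.
  have BF : B \in F by apply: building_pt => //; exact: (lv_face0 (height1 hP)).
  have [|Bk] := boolP (B \in kappa F).
    by rewrite kappa_top finset.inE => /eqP->.
  have BD : B \in D by rewrite finset.in_setD Bk.
  have /andP[dB0 dB1] := d01 B BD.
  have -> : face_center B = (1 - delta B) *: lifted_center delta B + (1 - (1 - delta B)) *: o.
    rewrite /lifted_center /lifted scalerDr scalerA mulfV ?scale1r; last first.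
      by rewrite subr_eq0 gt_eqF.
    by rewrite addrAC -scalerDl [1 - delta B + _]addrC subrK scale1r addrC subrK.
  move/convexP: (@conv_hull_convex _ _ X); apply=> //.
  - by apply: conv_hull_gen; right; exists B.
  - by rewrite subr_gt0.
  - by rewrite gtrBl.
move=> _ [->|[B /= BD <-]].
  by apply: conv_hull_mono (face_center_in hP top_gt_bot) => y; left.
by apply: conv_hull_gen; right; exists B => //=; rewrite mem_enum.
Qed.

Lemma generators_perm delta s s' : s =i s' -> generators delta s = generators delta s'.
Proof.
move=> ss'; congr (_ `|` _); apply/seteqP.
by split=> _ [B /= Bs <-]; exists B; rewrite //= ?ss' // -ss'.
Qed.

(** A functional with value [-1] at [o] is an affine function on the space of [P],
    and [dot_lifted] turns its value at a lifted point into a depth condition. *)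
Lemma realize_connected delta :
  (forall B, B \in (F :\: kappa F)%SET -> delta B < 1) ->
  (forall N : {set L}, N \subset (F :\: kappa F)%SET ->
     nested_set F (N :|: kappa F)%SET <-> exists u : 'rV[R]_(d + 1),
    (forall K, K \in kappa F -> dot u (barycenter K) = -1) /\
    forall B, B \in (F :\: kappa F)%SET -> dot u (barycenter B) <= - delta B /\
       (dot u (barycenter B) == - delta B) = (B \in N)) ->
  complex_iso (facial_nested_complex F) (boundary_complex
    (conv_hull ([set o] `|` [set lifted_center delta B | B in [set` (F :\: kappa F)%SET]]))).
Proof.
move=> d1 H; set D := (F :\: kappa F)%SET in d1 H *.
have l0 B : B \in D -> 0 < (1 - delta B)^-1 by move=> BD; rewrite invr_gt0 subr_gt0 d1.
have D0 B : B \in D -> (\bot < B)%O by rewrite finset.in_setD => /andP[_ /F0].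
rewrite /facial_nested_complex nested_complexE.
apply: (@realize_complex R d L D (lifted_center delta) o (fun N => nested_set F (N :|: kappa F)%SET)).
- move=> n b nq no B BD.
  have tight C : dot (- slack n b) (barycenter C) = 0.
    apply: (kappa_tight hP bF) => [K|C' C'D].
      rewrite kappa_top finset.inE => /eqP->.
      by rewrite dotNl -(slack_face_center hP) ?top_gt_bot// no subrr oppr0.
    have := nq C' C'D; rewrite -subr_le0 dot_lifted ?d1// no subrr mulr0 addr0.
    by rewrite pmulr_rle0 ?l0// dotNl -(slack_face_center hP) ?D0// opprB.
  apply/eqP; rewrite -subr_eq0 dot_lifted ?d1// no subrr mulr0 addr0.
  by rewrite -[dot n (face_center B) - b]opprB (slack_face_center hP) ?D0// -dotNl tight mulr0.
- move=> N ND; rewrite H//; split=> [[u [uk uD]]|[n [b [no nP]]]].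
    pose n := lsubmx u; pose b := - rsubmx u 0 0.
    have nE C : (\bot < C)%O -> dot n (face_center C) - b = dot u (barycenter C).
      by move=> C0; rewrite -(homogenize_face_center hP C0) dot_homogenize opprK.
    have nob : dot n o - b = -1.
      by rewrite nE ?top_gt_bot// uk// kappa_top finset.inE.
    exists n, b; split=> [|B BD]; first by rewrite -subr_lt0 nob oppr_lt0 ltr01.
    have E : dot n (lifted_center delta B) - b = (1 - delta B)^-1 * (dot u (barycenter B) + delta B).
      by rewrite dot_lifted ?d1// nE ?D0// -[b - _]opprB nob opprK mulr1.
    by have [-> ->] := sign_scale (l0 B BD) E; apply: uD.
  have bo : 0 < b - dot n o by rewrite subr_gt0.
  have uE C : (\bot < C)%O -> dot (- (b - dot n o)^-1 *: slack n b) (barycenter C) =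
      - (b - dot n o)^-1 * (b - dot n (face_center C)).
    by move=> C0; rewrite dotZl -(slack_face_center hP).
  exists (- (b - dot n o)^-1 *: slack n b); split=> [K|B BD].
    rewrite kappa_top finset.inE => /eqP->.
    by rewrite uE ?top_gt_bot// mulNr mulVf ?gt_eqF.
  have E : dot n (lifted_center delta B) - b = (b - dot n o) * (1 - delta B)^-1 *
     (dot (- (b - dot n o)^-1 *: slack n b) (barycenter B) + delta B).
    have nz1 : b - dot n o != 0 by rewrite gt_eqF.
    have nz2 : 1 - delta B != 0 by rewrite -invr_eq0 gt_eqF ?l0.
    by rewrite uE ?D0// dot_lifted ?d1//; field; rewrite ?nz1 ?nz2.
  by have [<- <-] := sign_scale (mulr_gt0 bo (l0 B BD)) E; apply: nP.
- by move=> B BD; apply: nested_single.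
Qed.

(** The functional exposing [B] is positive at the barycenters of the faces not
    below [B], so it stays positive when these are lifted by a small amount. *)
Lemma eta_small (eta : R) : 0 < eta -> exists2 eta', 0 < eta' <= eta &
  forall B C, ~~ (C <= B)%O ->
     eta' * dot (g B) (barycenter (\top%O : L)) < dot (g B) (barycenter C).
Proof.
move=> e0.
have [G G1 gG] := fin_upper (fun B : L => dot (g B) (barycenter (\top%O : L))).
have [gamma gamma0 gP] := fin_lower (Q := fun p : L * L => ~~ (p.2 <= p.1)%O)
  (f := fun p => dot (g p.1) (barycenter p.2)) (fun p => @face_functional_barycenter _ _ _ p.1 p.2).
have G0 : 0 < G by apply: lt_le_trans G1.
exists (Num.min eta (gamma / (2 * G))).
  by rewrite lt_min e0 divr_gt0 ?mulr_gt0//= ge_min lexx.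
move=> B C CB; apply: lt_le_trans (gP (B, C) CB).
set x := dot _ _.
have x0 : 0 <= x by apply: dot_barycenter_ge0 => a _; apply: face_functional_ge0.
apply: (@le_lt_trans _ _ (gamma / (2 * G) * G)).
  apply: ler_pM; rewrite ?lt_min ?ge_min ?lexx ?orbT//; last exact: gG.
  by rewrite le_min ltW// divr_ge0// ltW// mulr_gt0.
have -> : gamma / (2 * G) * G = gamma / 2 by field; rewrite gt_eqF.
by rewrite ltr_pdivrMr ?ltr_pMr ?ltr1n.
Qed.

Lemma decreasing_enum (D : {set L}) :
  exists s, s =i D /\ pairwise (fun C B => ~~ (C <= B)%O) s.
Proof.
pose le C B := (#|lv_set B| <= #|lv_set C|)%N.
exists (sort le (enum D)); split=> [B|]; first by rewrite mem_sort mem_enum.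
have /andP[neq lep] : pairwise (fun C B => C != B) (sort le (enum D)) &&
    pairwise le (sort le (enum D)).
  rewrite -uniq_pairwise sort_uniq enum_uniq -sorted_pairwise /=.
    by apply: sort_sorted => B C; apply: leq_total.
  by move=> B C K /= h1 h2; apply: leq_trans h2 h1.
have := pairwise_relI (fun C B => C != B) le (sort le (enum D)).
rewrite neq lep; apply: sub_pairwise => C B /= /andP[CB cBC].
apply: contra CB => leCB; apply/eqP/val_inj/eqP.
by rewrite eqEcard -lv_leE leCB.
Qed.

Lemma connected_case : exists Q : set 'rV[R]_d,
  [/\ polytope Q,
      complex_iso (facial_nested_complex F) (boundary_complex Q),
      clos_refl_trans _ stellar_subdivision P Q
    & forall p : 'rV[R]_d, relint P p ->
        clos_refl_trans _ face_truncation (polar p P) (polar p Q)].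
Proof.
have [eta0 [e00 e01 H]] := nested_weights hP bF.
have [eta /andP[e0 ee0] small] := eta_small e00.
have e1 : eta < 1 := le_lt_trans ee0 e01.
have [s [sD ps]] := decreasing_enum (F :\: kappa F)%SET.
have [|delta [dpos dlt st pst]] := subdivision_chain e0 e1 small _ ps.
  by move=> B; rewrite sD.
pose delta' B := if B \in kappa F then 1 else delta B.
have d'D B : B \in (F :\: kappa F)%SET -> delta' B = delta B.
  by rewrite finset.in_setD /delta' => /andP[/negbTE->].
have hd : hierarchy F eta0 delta'.
  apply: (hierarchy_le ee0); split=> [K|B BF|B C BF CF CB].
  - by rewrite /delta' => ->.
  - rewrite /delta'; case: ifPn => [//|Bk].
    by have /andP[] : 0 < delta B <= eta by apply: dpos; rewrite sD finset.in_setD Bk.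
  have CD : C \in (F :\: kappa F)%SET.
    rewrite finset.in_setD CF andbT; apply/negP => /max_elts_le /(_ BF (ltW CB)) E.
    by rewrite E ltxx in CB.
  rewrite d'D// /delta'; case: ifPn => Bk.
    by rewrite mulr1; have /andP[] := dpos C (etrans (sD C) CD).
  by apply: dlt; rewrite ?sD// finset.in_setD Bk.
exists (conv_hull (generators delta s)); split=> //.
  by eexists; [exact: finite_generators|].
have d1 B : B \in (F :\: kappa F)%SET -> 0 < delta B < 1.
  by move=> BD; have /andP[-> /le_lt_trans->] := dpos B (etrans (sD B) BD).
have -> : generators delta s = generators delta (enum (F :\: kappa F)%SET).
  by apply: generators_perm => B; rewrite sD mem_enum.
rewrite conv_hull_lifted_centers//; apply: realize_connected => [B /d1/andP[]//|N ND].
rewrite (H delta' hd)//; split=> -[u [uk uD]]; exists u; split=> // B BD.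
  by rewrite -d'D//; apply: uD.
by rewrite d'D//; apply: uD.
Qed.

End Connected.

Local Open Scope classical_set_scope.

Theorem theorem7p4 (R : realType) (d : nat) (P : set 'rV[R]_d)
    (F : {set lvFace (polytope_matroid P)}) :
  polytope P -> facial_building_set F ->
  (exists (e : nat) (Q : set 'rV[R]_e),
      polytope Q /\ complex_iso (facial_nested_complex F) (boundary_complex Q)) /\
  (building_connected F ->
   exists Q : set 'rV[R]_d,
     [/\ polytope Q,
         complex_iso (facial_nested_complex F) (boundary_complex Q),
         clos_refl_trans _ stellar_subdivision P Q
       & forall o : 'rV[R]_d, relint P o ->
           clos_refl_trans _ face_truncation (polar o P) (polar o Q)]).
Proof.
move=> hP bF; split; first exact: realize_quotient.
by move=> cF; apply: connected_case.
Qed.
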